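(* Let $q$ be a non-zero complex number which is not a root of unity, let $U^+=U_q^+(B_2)$, and let the torus $\mathcal{H}=(\mathbb{C}^* )^2$ act on $U^+$ by automorphisms via $(h_1,h_2).e_i=h_ie_i$ for $i\in\{1,2\}$. Let $\mathcal{P}$ be the set of those monic irreducible polynomials $P(z,z')\in\mathbb{C}[z,z']$ with $P(z,z')\neq z$ and $P(z,z')\neq z'$. Then $$\mathrm{Spec}_{\langle 0\rangle}(U^+)=\{\langle0\rangle\}\cup\{\langle P(z,z')\rangle\mid P(z,z')\in\mathcal{P}\}\cup\{\langle z-\alpha,z'-\beta\rangle\mid\alpha,\beta\in\mathbb{C}^*\}.$$ Further, for all $P(z,z')\in\mathcal{P}$ the prime ideal $\langle P(z,z')\rangle$ has height $1$, and for all $\alpha,\beta\in\mathbb{C}^*$ the prime ideal $\langle z-\alpha,z'-\beta\rangle$ has height $2$.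
   Context: $U^+=U_q^+(B_2)$ is the unital associative $\mathbb{C}$-algebra generated by $e_1,e_2$ subject to the quantum Serre relations $e_1^2e_2-(q^2+q^{-2})e_1e_2e_1+e_2e_1^2=0$ and $e_2^3e_1-(q^2+1+q^{-2})e_2^2e_1e_2+(q^2+1+q^{-2})e_2e_1e_2^2-e_1e_2^3=0$. Set $e_3=e_1e_2-q^2e_2e_1$, $\overline{e_3}=e_1e_2-q^{-2}e_2e_1$, $z=e_2e_3-q^2e_3e_2$ and $z'=(1-q^{-2})\left(e_3\overline{e_3}+(1+q^{-2})ze_1\right)$; the center of $U^+$ is the polynomial ring $\mathbb{C}[z,z']$ in two variables. ''Monic'' means leading coefficient $1$ with respect to a fixed monomial order on $\mathbb{C}[z,z']$ (a normalisation of irreducible polynomials up to non-zero scalars). $\langle\cdots\rangle$ denotes the two-sided ideal of $U^+$ generated by the listed elements. $\mathrm{Spec}(U^+)$ is the set of prime ideals of $U^+$. For a prime ideal $J$ that is $\mathcal{H}$-invariant (i.e. $h.J=J$ for all $h\in\mathcal{H}$), the $\mathcal{H}$-stratum is $\mathrm{Spec}_J(U^+)=\{P\in\mathrm{Spec}(U^+)\mid\bigcap_{h\in\mathcal{H}}h.P=J\}$. *)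

(* Defs.v *)
From HB Require Import structures.
From mathcomp Require Import all_boot all_order all_algebra.
From mathcomp Require Import boolp classical_sets.
From mathcomp Require Import complex reals.
From mathcomp Require Import ring.
From mathcomp Require finmap.
From mathcomp Require monalg.
From mathcomp Require Import mpoly.

Set Implicit Arguments.
Unset Strict Implicit.
Unset Printing Implicit Defensive.

Import GRing.Theory.
Local Open Scope classical_set_scope.
Local Open Scope ring_scope.
Local Open Scope quotient_scope.

Section Ideals.
Context (A : nzRingType).
Implicit Types (I P S : set A).

Definition two_sided_ideal I : Prop :=
  [/\ I 0, forall x y, I x -> I y -> I (x + y)
    & forall a b x, I x -> I (a * x * b)].

Definition ideal_gen S : set A := smallest two_sided_ideal S.

Definition prime_ideal P : Prop :=
  [/\ two_sided_ideal P, P != [set: A]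
    & forall I J, two_sided_ideal I -> two_sided_ideal J ->
        (forall x y, I x -> J y -> P (x * y)) -> I `<=` P \/ J `<=` P].

Definition prime_chain P (n : nat) (c : nat -> set A) : Prop :=
  [/\ forall i, (i <= n)%N -> prime_ideal (c i),
      forall i, (i < n)%N -> c i `<` c i.+1
    & c n = P].

Definition has_height P (n : nat) : Prop :=
  (exists c, prime_chain P n c) /\
  (forall m c, prime_chain P m c -> (m <= n)%N).

Lemma two_sided_idealN I x : two_sided_ideal I -> I x -> I (- x).
Proof. by case=> _ _ IM Ix; have := IM (-1) 1 x Ix; rewrite mulN1r mulr1. Qed.

Lemma ideal_gen_ideal S : two_sided_ideal (ideal_gen S).
Proof.
split=> [I [[]]//|x y Sx Sy I HI|a b x Sx I HI].
  by case: (HI) => -[_ ID _] _; apply: ID; [apply: Sx|apply: Sy].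
by case: (HI) => -[_ _ IM] _; apply: IM; apply: Sx.
Qed.

End Ideals.

Definition irreducible_elt (A : idomainType) (p : A) : Prop :=
  [/\ p != 0, p \isn't a GRing.unit
    & forall a b : A, p = a * b ->
        a \is a GRing.unit \/ b \is a GRing.unit].

Section FreeAlgebra.
Import monalg.
Context (K : fieldType) (I : choiceType).

(* The monoid algebra of the words over I is the free associative K-algebra
   on I.  The alias is needed because multinomials reserves the algType
   instance of malg for commutative monoids. *)
Definition free_alg : Type := {malg K[{fmonom I}]}.
Local Notation F := free_alg.

HB.instance Definition _ := GRing.Lalgebra.copy F {malg K[{fmonom I}]}.

Lemma free_alg_scalerAr (k : K) (x y : F) : k *: (x * y) = x * (k *: y).
Proof.
rewrite scalerAl [LHS](malgMEw (msuppZ_le _ _) (finmap.fsubset_refl _)).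
rewrite [RHS](malgMEw (finmap.fsubset_refl _) (msuppZ_le _ _)).
apply: eq_bigr => i _; apply: eq_bigr => j _.
by rewrite !mcoeffZ mulrCA mulrA.
Qed.

HB.instance Definition _ :=
  GRing.Lalgebra_isAlgebra.Build K F free_alg_scalerAr.

Definition free_gen (i : I) : F := << fmu i >>.

Context (A : algType K) (a : I -> A).

Definition word_eval (w : {fmonom I}) : A := \prod_(i <- fmonom_val w) a i.

Lemma word_eval_mmorphism : mmorphism word_eval.
Proof.
by split; rewrite /word_eval ?fm1 ?big_nil // => v w; rewrite fmM big_cat.
Qed.

HB.instance Definition _ :=
  isMultiplicative.Build {fmonom I} A word_eval word_eval_mmorphism.

(* free_eval and the operations of the quotient below are locked to keep
   conversion from unfolding them. *)
Fact free_eval_key : unit. Proof. exact: tt. Qed.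
Definition free_eval : F -> A :=
  locked_with free_eval_key (mmap (in_alg A) word_eval).

Lemma free_evalE : free_eval = mmap (in_alg A) word_eval.
Proof. exact: unlock. Qed.

Lemma free_eval_zmod : zmod_morphism free_eval.
Proof. by rewrite free_evalE; exact: raddfB. Qed.

Lemma free_eval_monoid : monoid_morphism free_eval.
Proof.
have [hM h1] : multiplicative free_eval.
  rewrite free_evalE; apply: commr_mmap_is_multiplicative => x m m'.
  by rewrite /GRing.comm /= mulr_algl mulr_algr.
by [].
Qed.

Lemma free_eval_scalable : scalable free_eval.
Proof. by move=> k x; rewrite free_evalE mmapZ /= mulr_algl. Qed.

HB.instance Definition _ :=
  GRing.isZmodMorphism.Build F A free_eval free_eval_zmod.
HB.instance Definition _ :=
  GRing.isMonoidMorphism.Build F A free_eval free_eval_monoid.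
HB.instance Definition _ :=
  GRing.isScalable.Build K F A *:%R free_eval free_eval_scalable.

Lemma free_evalU i : free_eval (free_gen i) = a i.
Proof. by rewrite free_evalE mmapU /= scale1r mul1r /word_eval fmU big_seq1. Qed.
End FreeAlgebra.

Section QuantumB2.
Context (K : fieldType) (q : K).

Definition serre1 (A : algType K) (x y : A) : A :=
  x ^+ 2 * y - (q ^+ 2 + q ^- 2) *: (x * y * x) + y * x ^+ 2.

Definition serre2 (A : algType K) (x y : A) : A :=
  y ^+ 3 * x - (q ^+ 2 + 1 + q ^- 2) *: (y ^+ 2 * x * y)
  + (q ^+ 2 + 1 + q ^- 2) *: (y * x * y ^+ 2) - x * y ^+ 3.

Lemma serre1_morph (A B : algType K) (f : {lrmorphism A -> B}) x y :
  f (serre1 x y) = serre1 (f x) (f y).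
Proof. by rewrite rmorphD rmorphB /= linearZ !(rmorphXn, rmorphM). Qed.

Lemma serre2_morph (A B : algType K) (f : {lrmorphism A -> B}) x y :
  f (serre2 x y) = serre2 (f x) (f y).
Proof.
by rewrite rmorphB rmorphD rmorphB /= !linearZ !(rmorphXn, rmorphM) /= scalerN.
Qed.

Local Notation F := (free_alg K 'I_2).
Local Notation x1 := (free_gen K (0 : 'I_2)).
Local Notation x2 := (free_gen K (1 : 'I_2)).

Definition serre_ideal : set F :=
  ideal_gen [set serre1 x1 x2; serre2 x1 x2].

Definition in_serre_ideal (x : F) : bool := `[< serre_ideal x >].

Lemma in_serre_ideal_zmod : zmod_closed in_serre_ideal.
Proof.
have HI := ideal_gen_ideal [set serre1 x1 x2; serre2 x1 x2].
have [I0 ID IM] := HI.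
split=> [|x y /asboolP Ix /asboolP Iy]; apply/asboolP => //.
exact: ID Ix (two_sided_idealN HI Iy).
Qed.

HB.instance Definition _ :=
  GRing.isZmodClosed.Build F in_serre_ideal in_serre_ideal_zmod.

Lemma serre_in : serre_ideal (serre1 x1 x2) /\ serre_ideal (serre2 x1 x2).
Proof.
have sI := @sub_gen_smallest F (@two_sided_ideal F)
  [set serre1 x1 x2; serre2 x1 x2].
by split; apply: sI; [left|right].
Qed.

(* An algebra morphism which kills the relators kills the ideal. *)
Lemma serre_ideal_eval (A : algType K) (a : 'I_2 -> A) :
  serre1 (a 0) (a 1) = 0 -> serre2 (a 0) (a 1) = 0 ->
  forall x, serre_ideal x -> free_eval a x = 0.
Proof.
move=> s1 s2.
suff: serre_ideal `<=` [set x | free_eval a x = 0] by [].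
apply: smallest_sub.
  split=> [|x y /= x0 y0|u v x /= x0]; first exact: rmorph0.
    by rewrite rmorphD /= x0 y0 addr0.
  by rewrite !rmorphM /= x0 mulr0 mul0r.
by move=> x [] ->; [rewrite /= serre1_morph|rewrite /= serre2_morph];
  rewrite /= !free_evalU.
Qed.

Lemma serre_ideal_proper : ~ serre_ideal 1.
Proof.
move=> /(@serre_ideal_eval K^o (fun=> 0)).
rewrite /serre1 /serre2 !(expr0n, mulr0, mul0r, scaler0, subr0, addr0) rmorph1.
by move=> /(_ erefl erefl)/eqP; rewrite oner_eq0.
Qed.

Definition serre_zmodClosed : zmodClosed F :=
  GRing.ZmodClosed.clone F in_serre_ideal _.

Definition uqB2 : Type := Quotient.quot serre_zmodClosed.
HB.instance Definition _ := GRing.Zmodule.on uqB2.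
HB.instance Definition _ := EqQuotient.on uqB2.

Fact uqB2_key : unit. Proof. exact: tt. Qed.
Definition uqB2_pi : F -> uqB2 := locked_with uqB2_key \pi_uqB2.

Lemma uqB2_piE : uqB2_pi = \pi_uqB2.
Proof. exact: unlock. Qed.

Lemma uqB2_piP x y : uqB2_pi x = uqB2_pi y <-> serre_ideal (x - y).
Proof.
have eI : `[< serre_ideal (x - y) >] = (uqB2_pi x == uqB2_pi y).
  rewrite uqB2_piE; exact: (Quotient.idealrBE serre_zmodClosed x y).
by rewrite (rwP eqP) -eI; split=> /asboolP.
Qed.

Lemma uqB2_reprK u : uqB2_pi (repr u) = u.
Proof. by rewrite uqB2_piE reprK. Qed.

Lemma uqB2_pi_zmod : zmod_morphism uqB2_pi.
Proof. rewrite uqB2_piE; exact: raddfB. Qed.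

HB.instance Definition _ :=
  GRing.isZmodMorphism.Build F uqB2 uqB2_pi uqB2_pi_zmod.

Definition uqB2_mul : uqB2 -> uqB2 -> uqB2 :=
  locked_with uqB2_key (fun u v => uqB2_pi (repr u * repr v)).
Definition uqB2_scale : K -> uqB2 -> uqB2 :=
  locked_with uqB2_key (fun k u => uqB2_pi (k *: repr u)).

Lemma uqB2_pi_mul x y : uqB2_pi (x * y) = uqB2_mul (uqB2_pi x) (uqB2_pi y).
Proof.
have [_ ID IM] := ideal_gen_ideal [set serre1 x1 x2; serre2 x1 x2].
rewrite /uqB2_mul unlock; apply/uqB2_piP; set x' := repr _; set y' := repr _.
have Ix : serre_ideal (x - x') by apply/uqB2_piP; rewrite uqB2_reprK.
have Iy : serre_ideal (y - y') by apply/uqB2_piP; rewrite uqB2_reprK.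
have -> : x * y - x' * y' = 1 * (x - x') * y + x' * (y - y') * 1.
  by rewrite mul1r mulr1 mulrBl mulrBr addrA subrK.
by apply: ID; apply: IM.
Qed.

Lemma uqB2_pi_scale k x : uqB2_pi (k *: x) = uqB2_scale k (uqB2_pi x).
Proof.
have [_ _ IM] := ideal_gen_ideal [set serre1 x1 x2; serre2 x1 x2].
rewrite /uqB2_scale unlock; apply/uqB2_piP; set x' := repr _.
have Ix : serre_ideal (x - x') by apply/uqB2_piP; rewrite uqB2_reprK.
by rewrite -scalerBr -mulr_algl -[_ * _]mulr1; apply: IM.
Qed.

Lemma uqB2_mulA : associative uqB2_mul.
Proof.
move=> u v w; rewrite -[u]uqB2_reprK -[v]uqB2_reprK -[w]uqB2_reprK.
by rewrite -!uqB2_pi_mul mulrA.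
Qed.

Lemma uqB2_mul1 : left_id (uqB2_pi 1) uqB2_mul.
Proof. by move=> u; rewrite -[u]uqB2_reprK -uqB2_pi_mul mul1r. Qed.

Lemma uqB2_mulr1 : right_id (uqB2_pi 1) uqB2_mul.
Proof. by move=> u; rewrite -[u]uqB2_reprK -uqB2_pi_mul mulr1. Qed.

Lemma uqB2_mulDl : left_distributive uqB2_mul +%R.
Proof.
move=> u v w; rewrite -[u]uqB2_reprK -[v]uqB2_reprK -[w]uqB2_reprK.
by rewrite -raddfD -!uqB2_pi_mul -raddfD mulrDl.
Qed.

Lemma uqB2_mulDr : right_distributive uqB2_mul +%R.
Proof.
move=> u v w; rewrite -[u]uqB2_reprK -[v]uqB2_reprK -[w]uqB2_reprK.
by rewrite -raddfD -!uqB2_pi_mul -raddfD mulrDr.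
Qed.

Lemma uqB2_1_neq0 : uqB2_pi 1 != 0.
Proof.
apply/eqP; rewrite -(raddf0 uqB2_pi) => /uqB2_piP.
by rewrite subr0; apply: serre_ideal_proper.
Qed.

HB.instance Definition _ := GRing.Zmodule_isNzRing.Build uqB2
  uqB2_mulA uqB2_mul1 uqB2_mulr1 uqB2_mulDl uqB2_mulDr uqB2_1_neq0.

Lemma uqB2_scaleA a b u : uqB2_scale a (uqB2_scale b u) = uqB2_scale (a * b) u.
Proof. by rewrite -[u]uqB2_reprK -!uqB2_pi_scale scalerA. Qed.

Lemma uqB2_scale1 : left_id 1 uqB2_scale.
Proof. by move=> u; rewrite -[u]uqB2_reprK -uqB2_pi_scale scale1r. Qed.

Lemma uqB2_scaleDr : right_distributive uqB2_scale +%R.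
Proof.
move=> a u v; rewrite -[u]uqB2_reprK -[v]uqB2_reprK.
by rewrite -raddfD -!uqB2_pi_scale -raddfD scalerDr.
Qed.

Lemma uqB2_scaleDl u : {morph uqB2_scale^~ u : a b / a + b}.
Proof.
move=> a b; rewrite -[u]uqB2_reprK /= -!uqB2_pi_scale -raddfD.
by rewrite scalerDl.
Qed.

HB.instance Definition _ := GRing.Zmodule_isLmodule.Build K uqB2
  uqB2_scaleA uqB2_scale1 uqB2_scaleDr uqB2_scaleDl.

Lemma uqB2_scaleAl a (u v : uqB2) : a *: (u * v) = (a *: u) * v.
Proof.
rewrite -[u]uqB2_reprK -[v]uqB2_reprK.
rewrite -[_ * _]uqB2_pi_mul -[LHS]uqB2_pi_scale.
by rewrite -[a *: _]uqB2_pi_scale -[RHS]uqB2_pi_mul scalerAl.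
Qed.

Lemma uqB2_scaleAr a (u v : uqB2) : a *: (u * v) = u * (a *: v).
Proof.
rewrite -[u]uqB2_reprK -[v]uqB2_reprK.
rewrite -[_ * _]uqB2_pi_mul -[LHS]uqB2_pi_scale.
by rewrite -[a *: _]uqB2_pi_scale -[RHS]uqB2_pi_mul scalerAr.
Qed.

HB.instance Definition _ :=
  GRing.Lmodule_isLalgebra.Build K uqB2 uqB2_scaleAl.
HB.instance Definition _ :=
  GRing.Lalgebra_isAlgebra.Build K uqB2 uqB2_scaleAr.

Lemma uqB2_pi_monoid : monoid_morphism uqB2_pi.
Proof. by split; [exact: erefl | exact: uqB2_pi_mul]. Qed.

Lemma uqB2_pi_scalable : scalable uqB2_pi.
Proof. exact: uqB2_pi_scale. Qed.

HB.instance Definition _ :=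
  GRing.isMonoidMorphism.Build F uqB2 uqB2_pi uqB2_pi_monoid.
HB.instance Definition _ :=
  GRing.isScalable.Build K F uqB2 *:%R uqB2_pi uqB2_pi_scalable.

Definition e1 : uqB2 := uqB2_pi x1.
Definition e2 : uqB2 := uqB2_pi x2.

Lemma uqB2_serre1 : serre1 e1 e2 = 0.
Proof.
rewrite -(serre1_morph uqB2_pi) -(raddf0 uqB2_pi).
by apply/uqB2_piP; rewrite subr0; apply: serre_in.1.
Qed.

Lemma uqB2_serre2 : serre2 e1 e2 = 0.
Proof.
rewrite -(serre2_morph uqB2_pi) -(raddf0 uqB2_pi).
by apply/uqB2_piP; rewrite subr0; apply: serre_in.2.
Qed.

Definition e3 : uqB2 := e1 * e2 - q ^+ 2 *: (e2 * e1).
Definition e3bar : uqB2 := e1 * e2 - q ^- 2 *: (e2 * e1).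
Definition z : uqB2 := e2 * e3 - q ^+ 2 *: (e3 * e2).
Definition z' : uqB2 :=
  (1 - q ^- 2) *: (e3 * e3bar + (1 + q ^- 2) *: (z * e1)).

(* The torus acts by the substitution e_i |-> h_i e_i, computed on any
   representative in the free algebra (torus_act_pi). *)
Definition torus_gen (h : K * K) (i : 'I_2) : uqB2 :=
  if i == 0 then h.1 *: e1 else h.2 *: e2.

Definition torus_act (h : K * K) (u : uqB2) : uqB2 :=
  free_eval (torus_gen h) (repr u).

Lemma serre1_scale (A : algType K) (a b : K) (x y : A) :
  serre1 (a *: x) (b *: y) = (a ^+ 2 * b) *: serre1 x y.
Proof.
rewrite /serre1 !scalerDr !scalerN !exprZn.
rewrite -!(scalerAl, scalerAr) !scalerA.
by congr (_ *: _ - _ *: _ + _ *: _); ring.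
Qed.

Lemma serre2_scale (A : algType K) (a b : K) (x y : A) :
  serre2 (a *: x) (b *: y) = (a * b ^+ 3) *: serre2 x y.
Proof.
rewrite /serre2 !scalerDr !scalerN !exprZn.
rewrite -!(scalerAl, scalerAr) !scalerA.
by congr (_ *: _ - _ *: _ + _ *: _ - _ *: _); ring.
Qed.

Lemma torus_act_pi h x : torus_act h (uqB2_pi x) = free_eval (torus_gen h) x.
Proof.
apply/eqP; rewrite /torus_act -subr_eq0 -rmorphB /=; apply/eqP.
apply: serre_ideal_eval; last by apply/uqB2_piP; rewrite uqB2_reprK.
  by rewrite /torus_gen /= serre1_scale uqB2_serre1 scaler0.
by rewrite /torus_gen /= serre2_scale uqB2_serre2 scaler0.
Qed.

Lemma torus_act_zmod h : zmod_morphism (torus_act h).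
Proof.
move=> u v; rewrite -[u]uqB2_reprK -[v]uqB2_reprK -rmorphB /=.
by rewrite !torus_act_pi rmorphB.
Qed.

Lemma torus_act_monoid h : monoid_morphism (torus_act h).
Proof.
split=> [|u v].
  by rewrite -[X in torus_act h X](rmorph1 uqB2_pi) torus_act_pi rmorph1.
rewrite -[u]uqB2_reprK -[v]uqB2_reprK -rmorphM /=.
by rewrite !torus_act_pi rmorphM.
Qed.

Lemma torus_act_scalable h : scalable (torus_act h).
Proof.
move=> k u; rewrite -[u]uqB2_reprK -linearZ /=.
by rewrite !torus_act_pi linearZ.
Qed.

HB.instance Definition _ h :=
  GRing.isZmodMorphism.Build uqB2 uqB2 (torus_act h) (torus_act_zmod h).
HB.instance Definition _ h :=
  GRing.isMonoidMorphism.Build uqB2 uqB2 (torus_act h) (torus_act_monoid h).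
HB.instance Definition _ h :=
  GRing.isScalable.Build K uqB2 uqB2 *:%R (torus_act h) (torus_act_scalable h).

Lemma torus_act_e1 h : torus_act h e1 = h.1 *: e1.
Proof. by rewrite torus_act_pi free_evalU. Qed.

Lemma torus_act_e2 h : torus_act h e2 = h.2 *: e2.
Proof. by rewrite torus_act_pi free_evalU. Qed.

Definition torus : set (K * K) := [set h | h.1 != 0 /\ h.2 != 0].

Definition stratum (J : set uqB2) : set (set uqB2) :=
  [set P | prime_ideal P /\ \bigcap_(h in torus) (torus_act h @` P) = J].
End QuantumB2.

Section CentralPolynomials.
Context (K : fieldType) (q : K).

(* mmap writes the powers of z to the left of those of z'; the order is
   irrelevant since both elements are central. *)
Definition eval_zz' (P : {mpoly K[2]}) : uqB2 q :=
  mpoly.mmap (in_alg (uqB2 q)) (fun i => if i == 0 then z q else z' q) P.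

(* "Monic" refers to the monomial order of the multinomials library. *)
Definition calP : set {mpoly K[2]} :=
  [set P | [/\ irreducible_elt P, mleadc P = 1, P != 'X_0 & P != 'X_1]].
End CentralPolynomials.

Arguments calP : clear implicits.

(* Main.v *)
(** Put c = e3, w = e2 e3 - e3 e2.  Then w c = q^2 c w, while e2 is a multiple of
c^-1 (w - z) and e1 equals w^-1 (a z' - b c^2) for nonzero scalars a, b.  Hence U
acts on the quantum torus over C[z, z'] with generators x = c and y = w,
yx = q^2 xy, and applying u to 1 gives an expansion theta u of u.

- The elements c^n or e2^n, multiplied on the left by w^m or e1^m, span U over
  C[z, z'], and their lowest terms are the monomials x^i y^j, (i, j) in Z^2, with
  coefficients that are scalar multiples of monomials in z, z'.  So for a prime p of C[z, z']
  containing neither z nor z', an element u lies in pU if and only if the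
  coefficients of theta u lie in p.  Thus pU is completely prime and lies over p.
- Multiplying on both sides by w and c isolates a single term of theta u inside
  the ideal of u; commutators with e1 and e2 then replace w by z' and c by z.  So
  a two-sided ideal J over such a p equals pU, and every nonzero ideal meets
  C[z, z'].  If the ideal is stable under the torus it contains a monomial in
  z, z', which identifies the stratum of 0 with the primes p avoiding z and z'.
- The primes of C[z, z'] are 0, the (P) with P irreducible, and the maximal
  ideals (z - a, z' - b), by Gauss' lemma and resultants, and their inclusions give the heights. *)

Require Import Defs.
From HB Require Import structures.
From mathcomp Require Import all_boot all_order all_algebra.
From mathcomp Require Import boolp classical_sets functions.
From mathcomp Require Import complex reals.
From mathcomp Require Import ring zify.
From mathcomp Require Import mpoly.

Set Implicit Arguments.
Unset Strict Implicit.
Unset Printing Implicit Defensive.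

Import Order.TTheory GRing.Theory Num.Theory.
Local Open Scope classical_set_scope.
Local Open Scope ring_scope.

(** An ordered word in e1, w, c, e2 shrinks whenever e1 meets w or c meets e2, because e1 w is a
    combination of z' and c^2, and c e2 one of w and z. The surviving words are a power of w or e1
    times a power of c or e2, hence the index set Z^2. The lowest coefficients of e1 and e2 are
    nonzero scalar multiples of z' and z; they survive reduction modulo p when p avoids both, and
    this is where membership in the stratum enters.

    The quantum torus is not built as a ring. Its elements are functions on Z^2; two linear
    operators on them satisfy the Serre relations, so the free algebra, and then U, acts. The
    product formula is recovered because this left action commutes with right multiplication by
    monomials.

    That q is not a root of unity separates exponents: the powers of q^2 are distinct, which
    isolates a term of theta u; the factors q^(4n) - q^(-4) and q^(2m+2) - 1 arising from e1 and e2
    are nonzero; and the torus characters of distinct monomials in z, z' differ. *)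

Section CommutativeIdeals.
Variable Z : comNzRingType.
Implicit Types (p : set Z) (a b f : Z).

Definition prime_set p : Prop :=
  [/\ p 0, forall a b, p a -> p b -> p (a + b), forall a b, p b -> p (a * b),
      ~ p 1 & forall a b, p (a * b) -> p a \/ p b].

Definition principal f : set Z := [set a | exists b, a = b * f].

Definition generated2 f g : set Z := [set a | exists b c, a = b * f + c * g].

Lemma prime_setB p a b : prime_set p -> p a -> p b -> p (a - b).
Proof. by case=> _ pD pM _ _ pa pb; apply: pD => //; rewrite -mulN1r; apply: pM. Qed.

Lemma prime_setMr p a b : prime_set p -> p a -> p (a * b).
Proof. by case=> _ _ pM _ _ pa; rewrite mulrC; apply: pM. Qed.

Lemma prime_setX p a n : prime_set p -> p (a ^+ n) -> p a.
Proof.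
case=> _ _ _ p1 pP; elim: n => [|n IH]; first by rewrite expr0.
by rewrite exprS => /pP[].
Qed.

Lemma prime_set_sum p (I : Type) (r : seq I) (P : pred I) (F : I -> Z) :
  prime_set p -> (forall i, P i -> p (F i)) -> p (\sum_(i <- r | P i) F i).
Proof. by case=> p0 pD _ _ _ pF; elim/big_ind: _ => // x y; apply: pD. Qed.

Lemma principal_id f : principal f f.
Proof. by exists 1; rewrite mul1r. Qed.

End CommutativeIdeals.

(** Descent on [mu]: a reducible element of [p] splits into two nonunits, one of which lies in [p]
    and has smaller [mu]. *)
Lemma prime_set_has_irreducible (Z : idomainType) (mu : Z -> nat) (p : set Z) :
  (forall a b, a * b != 0 -> b \isn't a GRing.unit -> (mu a < mu (a * b)%R)%N) ->
  prime_set p -> (exists2 f, p f & f != 0) ->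
  exists2 P, irreducible_elt P & p P.
Proof.
move=> muM prp; have [_ _ pM p1 pP] := prp.
suff ind n f : (mu f < n)%N -> p f -> f != 0 -> exists2 P, irreducible_elt P & p P.
  by case=> f pf f0; apply: (ind (mu f).+1 f).
elim: n f => // n IH f; rewrite ltnS => lefn pf f0.
have fNu : f \isn't a GRing.unit.
  by apply/negP => uf; apply: p1; rewrite -(mulVr uf); apply: pM.
have [irr|nirr] := pselect (irreducible_elt f); first by exists f.
have [a [b [eab ua ub]]] : exists a b,
    [/\ f = a * b, a \isn't a GRing.unit & b \isn't a GRing.unit].
  apply: contrapT => H; apply: nirr; split => // a b eab.
  have [|ua] := boolP (a \is a GRing.unit); first by left.
  have [|ub] := boolP (b \is a GRing.unit); first by right.
  by case: H; exists a, b.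
have ab0 : a * b != 0 by rewrite -eab.
have pab : p (a * b) by rewrite -eab.
case: (pP _ _ pab) => [pa|pb].
  apply: (IH a) => //; last by apply: contraNneq ab0 => ->; rewrite mul0r.
  by apply: leq_trans lefn; rewrite eab muM.
apply: (IH b) => //; last by apply: contraNneq ab0 => ->; rewrite mulr0.
by apply: leq_trans lefn; rewrite eab mulrC muM // mulrC.
Qed.

(** * Prime ideals of K[X][Y] over an algebraically closed field *)

Section BivariatePrimes.
Variable K : closedFieldType.
Local Notation S := {poly {poly K}}.
Implicit Types (f g h P : S) (c r : {poly K}) (x : K).

Local Notation line x := (('X - x%:P)%:P : S).
Local Notation spec x f := (map_poly (horner_eval x) f).

Lemma line_dvdP x f : (exists g, f = line x * g) <-> spec x f = 0.
Proof.
split=> [[g ->]|f0].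
  by rewrite rmorphM /= map_polyC /= /horner_eval !hornerE subrr mul0r.
exists (map_poly (fun c => c %/ ('X - x%:P)) f).
apply/polyP => i; rewrite coefCM coef_map_id0 ?div0p // mulrC divpK //.
by rewrite dvdp_XsubCl; move/polyP/(_ i): f0; rewrite coef_map coef0 => /eqP.
Qed.

(** Specialising X to x has values in the domain K[Y], and its kernel is generated by X - x. *)
Lemma line_dvdM x f g :
  (exists h, f * g = line x * h) ->
  (exists h, f = line x * h) \/ (exists h, g = line x * h).
Proof.
rewrite !line_dvdP rmorphM /= => /eqP; rewrite mulf_eq0.
by case/orP => /eqP; [left|right].
Qed.

Lemma line_neq0 x : line x != 0.
Proof. by rewrite polyC_eq0 polyXsubC_eq0. Qed.

Lemma closed_poly_factor c : (1 < size c)%N ->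
  exists x c', c = ('X - x%:P) * c'.
Proof.
move=> sc; have /closed_rootP[x /factor_theorem[c' ->]] : size c != 1%N.
  by rewrite neq_ltn sc orbT.
by exists x, c'; rewrite mulrC.
Qed.

(** Gauss' lemma by peeling: the linear factors of [c] are removed one at a time, each dividing [g]
    or [h] because it is prime in K[X][Y]. *)
Lemma gauss_factor c f g h : c != 0 -> c%:P * f = g * h ->
  exists c1 c2 g' h', [/\ g = c1%:P * g', h = c2%:P * h' & f = g' * h'].
Proof.
have [n] := ubnP (size c); elim: n c g h => // n IH c g h; rewrite ltnS => lecn c0 e.
have [sc|sc] := leqP (size c) 1.
  have uc : c \is a GRing.unit.
    rewrite poly_unitE eqn_leq sc lt0n size_poly_eq0 c0 /=.
    rewrite unitfE; apply: contraNneq c0 => e0.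
    by rewrite (size1_polyC sc) e0.
  have uC : (c%:P : S) \is a GRing.unit by rewrite rmorph_unit.
  exists c, 1, ((c^-1)%:P * g), h; split.
  - by rewrite mulrA -polyCM divrr // mul1r.
  - by rewrite mul1r.
  - by rewrite -mulrA -e mulrA -polyCM mulVr // mul1r.
have [x [c' ec]] := closed_poly_factor sc.
have c'0 : c' != 0 by apply: contraNneq c0 => c'0; rewrite ec c'0 mulr0.
have sc' : (size c' < n)%N.
  apply: leq_trans lecn; rewrite ec size_mul ?polyXsubC_eq0 //.
  by rewrite size_XsubC.
have : exists k, g * h = line x * k.
  by exists (c'%:P * f); rewrite -e ec polyCM mulrA.
case/line_dvdM => -[k ek].
  have : c'%:P * f = k * h.
    by apply: (mulfI (line_neq0 x)); rewrite mulrA -polyCM -ec e ek mulrA.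
  case/(IH c' _ _ sc' c'0) => c1 [c2 [g' [h' [ek' eh ef]]]].
  exists (('X - x%:P) * c1), c2, g', h'; split=> //.
  by rewrite ek ek' polyCM mulrA.
have : c'%:P * f = g * k.
  by apply: (mulfI (line_neq0 x)); rewrite mulrA -polyCM -ec e ek mulrCA.
case/(IH c' _ _ sc' c'0) => c1 [c2 [g' [h' [eg ek' ef]]]].
exists c1, (('X - x%:P) * c2), g', h'; split=> //.
by rewrite ek ek' polyCM mulrA.
Qed.

Lemma unit_size1 f : f \is a GRing.unit -> (size f <= 1)%N.
Proof. by rewrite poly_unitE => /andP[/eqP->]. Qed.

(** Gauss' lemma cancels [r] at the cost of a factor from K[X] in P; irreducibility makes that
    factor a unit, since the cofactor has positive degree in Y. *)
Lemma irreducible_dvd_scaled P f g r : irreducible_elt P -> (1 < size P)%N ->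
  r != 0 -> r%:P * f = g * P -> principal P f.
Proof.
move=> [P0 Pu irr] sP r0 /(gauss_factor r0)[c1 [c2 [g' [h' [_ eP ->]]]]].
case: (irr _ _ eP) => [u|/unit_size1 sh].
  by exists (g' * (c2%:P)^-1); rewrite eP mulrA mulrVK.
move: sP; rewrite eP ltnNge => /negP[]; apply: leq_trans (size_polyMleq _ _) _.
by rewrite -subn1 leq_subLR; apply: leq_add => //; apply: size_polyC_leq1.
Qed.

(** A nonzero resultant is the required [r]. If it vanishes, P and f share a factor of positive
    degree in Y, which Gauss' lemma turns into an associate of P dividing f. *)
Lemma irreducible_bezout P f : irreducible_elt P -> (1 < size P)%N ->
  ~ principal P f -> exists r u v, r != 0 /\ r%:P = u * P + v * f.
Proof.
move=> irr sP nPf; have [P0 _ irrP] := irr.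
have [sf|sf] := leqP (size f) 1.
  (* When f is constant in Y it is itself the required element of K[X]. *)
  exists f`_0, 0, 1; rewrite mul0r add0r mul1r -size1_polyC //; split=> //.
  apply/eqP => e0; apply: nPf; exists 0.
  by rewrite mul0r (size1_polyC sf) e0 polyC0.
have [[u v] _ e] := resultant_in_ideal sP sf.
exists (resultant P f), u, v; split=> //.
rewrite resultant_eq0; apply/negP => sd; apply: nPf.
set d := gcdp P f in sd.
have /Pdiv.Idomain.dvdpP[[c k] /= c0 ek] := dvdp_gcdl P f.
have /Pdiv.Idomain.dvdpP[[c' k'] /= c'0 ek'] := dvdp_gcdr P f.
rewrite -/d -mul_polyC in ek; rewrite -/d -mul_polyC in ek'.
have [c1 [c2 [g' [h' [_ eh eP]]]]] := gauss_factor c0 ek.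
have uh : ~~ (h' \is a GRing.unit).
  apply/negP => /unit_size1 sh; move: sd.
  rewrite eh ltnNge => /negP[]; apply: leq_trans (size_polyMleq _ _) _.
  by rewrite -subn1 leq_subLR; apply: leq_add => //; apply: size_polyC_leq1.
case: (irrP _ _ eP) => [ug|]; last by rewrite (negPf uh).
apply: (irreducible_dvd_scaled (g := k' * c2%:P * g'^-1) irr sP c'0).
by rewrite ek' eh eP -!mulrA mulKr.
Qed.

Lemma irreducible_const P : irreducible_elt P -> (size P <= 1)%N ->
  exists x u, u \is a GRing.unit /\ P = u * line x.
Proof.
move=> [P0 Pu irr] sP; have eP := size1_polyC sP.
have sc : (1 < size (P`_0)%R)%N.
  rewrite ltnNge; apply: contra Pu => sc.
  rewrite eP (size1_polyC sc) !rmorph_unit // unitfE.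
  apply: contraNneq P0 => e0.
  by rewrite eP (size1_polyC sc) e0 !polyC0.
have [x [c' ec]] := closed_poly_factor sc.
have eP' : P = line x * c'%:P by rewrite -polyCM -ec.
case: (irr _ _ eP') => u; last by exists x, c'%:P; rewrite mulrC.
move: u; rewrite poly_unitE coefC eqxx /= => /andP[_].
by rewrite poly_unitE size_XsubC.
Qed.

Lemma bivariate_irreducible_prime P : irreducible_elt P -> prime_set (principal P).
Proof.
move=> irr; have [P0 Pu irrP] := irr; split.
- by exists 0; rewrite mul0r.
- by move=> a b [a' ->] [b' ->]; exists (a' + b'); rewrite mulrDl.
- by move=> a b [b' ->]; exists (a * b'); rewrite mulrA.
- case=> b e; move/negP: Pu; apply.
  by apply/unitrP; exists b; rewrite [P * b]mulrC.
move=> f g [h e]; have [sP|sP] := leqP (size P) 1.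
  have [x [u [uu eP]]] := irreducible_const irr sP.
  have : exists k, f * g = line x * k.
    by exists (h * u); rewrite e eP mulrA mulrC.
  by case/line_dvdM => -[k ->]; [left|right]; exists (k * u^-1);
    rewrite eP mulrA mulrVK // mulrC.
have [|nf] := pselect (principal P f); [by left|right].
(* Euclid's argument up to the factor [r]: from r = u P + v f and f g = h P follows r g = (u g + v
   h) P. *)
have [r [u [v [r0 er]]]] := irreducible_bezout irr sP nf.
apply: (irreducible_dvd_scaled (g := u * g + v * h) irr sP r0).
by rewrite er !mulrDl -!mulrA e [P * g]mulrC.
Qed.

Lemma line_irreducible x : irreducible_elt (line x).
Proof.
split; first exact: line_neq0.
  rewrite poly_unitE coefC eqxx negb_and; apply/orP; right.
  by rewrite poly_unitE size_XsubC.
have lineM a b : line x = (line x * a) * b -> b \is a GRing.unit.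
  move=> e; have e1 : 1 = a * b.
    by apply: (mulfI (line_neq0 x)); rewrite mulr1 mulrA.
  by apply/unitrP; exists a; rewrite [b * a]mulrC.
move=> a b e; have : exists k, a * b = line x * k by exists 1; rewrite -e mulr1.
case/line_dvdM => -[k ek]; [right|left].
  by apply: (lineM k); rewrite -ek.
by apply: (lineM k); rewrite -ek mulrC.
Qed.

(** The embedding [phi] is a parameter because the lemma serves twice: for polynomials in X and for
    polynomials in Y. *)
Lemma prime_set_root (Z : comNzRingType) (p : set Z)
    (phi : {rmorphism {poly K} -> Z}) c : prime_set p ->
  c != 0 -> p (phi c) -> exists x, p (phi ('X - x%:P)).
Proof.
move=> prp; have [_ _ pM p1 pP] := prp.
have [n] := ubnP (size c); elim: n c => // n IH c; rewrite ltnS => lecn c0 pc.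
have [sc|sc] := leqP (size c) 1.
  have c00 : c`_0 != 0.
    by apply: contraNneq c0 => e0; rewrite (size1_polyC sc) e0.
  case: p1; have <- : phi ((c`_0)^-1%:P * c) = 1.
    by rewrite {2}(size1_polyC sc) -polyCM mulVf // rmorph1.
  by rewrite rmorphM; apply: pM.
have [x [c' ec]] := closed_poly_factor sc.
move: pc; rewrite ec rmorphM => /pP[px|]; first by exists x.
apply: IH; last by apply: contraNneq c0 => c'0; rewrite ec c'0 mulr0.
apply: leq_trans lecn; rewrite ec size_mul ?polyXsubC_eq0 //; first by rewrite size_XsubC.
by apply: contraNneq c0 => c'0; rewrite ec c'0 mulr0.
Qed.

Lemma spec_congr x f : exists g, f = line x * g + (spec x f)^:P.
Proof.
have /line_dvdP[g e] : spec x (f - (spec x f)^:P) = 0.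
  rewrite rmorphB /= -map_poly_comp /=; apply/eqP; rewrite subr_eq0; apply/eqP.
  by rewrite [RHS]map_poly_id // => i _ /=; rewrite /horner_eval hornerC.
by exists g; rewrite -e subrK.
Qed.

Lemma point_congr x y f : exists a g h,
  f = a%:P%:P + g * line x + h * ('X - y%:P%:P).
Proof.
have [g eg] := spec_congr x f.
have /factor_theorem[h eh] : root (spec x f - (spec x f).[y]%:P) y.
  by rewrite /root !hornerE subrr.
exists (spec x f).[y], g, (h^:P); rewrite {1}eg.
have := congr1 (map_poly polyC) eh.
rewrite rmorphM !rmorphB /= !map_polyC map_polyX /= => <-.
by ring.
Qed.

Lemma bivariate_prime_classification (p : set S) : prime_set p ->
  [\/ p = [set 0], exists2 P, irreducible_elt P & p = principal P
    | exists x y, p = generated2 (line x) ('X - y%:P%:P)].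
Proof.
move=> prp; have [p0 pD pM p1 pP] := prp.
have principal_sub P : p P -> principal P `<=` p by move=> pP' f [g ->]; apply: pM.
have [nz|z] := pselect (exists2 f, p f & f != 0); last first.
  constructor 1; apply/seteqP; split=> [f pf|f ->] //=; apply: contrapT => /eqP f0.
  by apply: z; exists f.
have [P irr pPP] : exists2 P, irreducible_elt P & p P.
  (* The measure adds the size in Y and the size in X of the leading coefficient. Both are additive
     up to a shift, and a nonzero polynomial of measure 2 is a constant of K, hence a unit. *)
  apply: (prime_set_has_irreducible
    (mu := fun f => (size f + size (lead_coef f))%N)) prp nz => a b ab0 ub.
  move: (ab0); rewrite mulf_eq0 negb_or => /andP[a0 b0].
  rewrite lead_coefM !size_mul ?lead_coef_eq0 //.
  have sb : (0 < size b)%N by rewrite lt0n size_poly_eq0.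
  have slb : (0 < size (lead_coef b))%N by rewrite lt0n size_poly_eq0 lead_coef_eq0.
  suff : (2 < size b + size (lead_coef b))%N.
    have aux m n k l : (0 < k -> 0 < l -> 2 < k + l ->
      m + n < (m + k).-1 + (n + l).-1)%N by lia.
    exact: aux.
  rewrite ltnNge; apply: contra ub => le2.
  have aux m n : (0 < m -> 0 < n -> m + n <= 2 -> m = 1 /\ n = 1)%N by lia.
  have [sb1 slb1] := aux _ _ sb slb le2.
  have eb : b = (b`_0)%:P by apply: size1_polyC; rewrite sb1.
  have lb : lead_coef b = b`_0 by rewrite {1}eb lead_coefC.
  rewrite lb in slb1.
  have eb0 : b`_0 = (b`_0`_0)%:P by apply: size1_polyC; rewrite slb1.
  rewrite eb eb0 !rmorph_unit // unitfE; apply: contraNneq b0 => e0.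
  by rewrite eb eb0 e0.
have [ppr|nppr] := pselect (p `<=` principal P).
  by constructor 2; exists P => //; apply/seteqP; split=> //; apply: principal_sub.
(* A prime strictly above (P) meets K[X]: in P itself if P is constant in Y, and otherwise in a
   Bezout combination of P with an element outside (P). *)
have [r r0 pr] : exists2 r, r != 0 & p r%:P.
  have [sP|sP] := leqP (size P) 1.
    exists P`_0; last by rewrite -size1_polyC.
    have [P0 _ _] := irr; apply: contraNneq P0 => e0.
    by rewrite (size1_polyC sP) e0.
  have [f /= pf nf] : exists2 f, p f & ~ principal P f.
    apply: contrapT => H; apply: nppr => f pf; apply: contrapT => nf.
    by apply: H; exists f.
  have [r [u [v [r0 er]]]] := irreducible_bezout irr sP nf.
  by exists r => //; rewrite er; apply: pD; apply: pM.
have [x px] : exists x, p (line x) := prime_set_root prp r0 pr.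
have [pl|npl] := pselect (p `<=` principal (line x)).
  constructor 2; exists (line x); first exact: line_irreducible.
  by apply/seteqP; split=> //; apply: principal_sub.
have [f /= pf nf] : exists2 f, p f & ~ principal (line x) f.
  apply: contrapT => H; apply: npl => f pf; apply: contrapT => nf.
  by apply: H; exists f.
have [g eg] := spec_congr x f.
(* An element of [p] not divisible by X - x specialises to a nonzero polynomial in Y, which still
   lies in [p] because X - x does. *)
have [y py] : exists y, p (('X - y%:P)^:P).
  apply: (prime_set_root (phi := map_poly polyC) prp (c := spec x f)).
    apply/eqP => /line_dvdP[k ek]; apply: nf; exists k; by rewrite mulrC.
  rewrite /=; have -> : (spec x f)^:P = f - line x * g by rewrite [in RHS]eg addrAC subrr add0r.
  by apply: prime_setB => //; apply: prime_setMr.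
rewrite rmorphB /= map_polyX map_polyC /= in py.
constructor 3; exists x, y; apply/seteqP; split=> [h ph|h [a [b ->]]]; last first.
  by apply: pD; apply: pM.
have [a [u [v eh]]] := point_congr x y h; rewrite eh.
(* [a] is the value of h at the point (x, y); a nonzero value would be a unit in [p]. *)
suff -> : a = 0 by exists u, v; rewrite !polyC0 add0r.
apply: contrapT => /eqP a0; apply: p1.
have <- : (a^-1)%:P%:P * a%:P%:P = 1 :> S by rewrite -!polyCM mulVf.
apply: (pM); have -> : a%:P%:P = h - u * line x - v * ('X - y%:P%:P).
  by rewrite [in RHS]eh; ring.
by apply: prime_setB; [|apply: prime_setB|]; rewrite // -?mulrBr; apply: (pM).
Qed.

End BivariatePrimes.

(** * Deciding linear identities between noncommutative words *)

Section LinearCombinations.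
Variables (K : fieldType) (V : lmodType K).

(* Reified K-linear expressions in a list of atoms, to decide linear
   identities between monomials of a noncommutative algebra. *)
Inductive lin_expr :=
  | LinAtom of nat
  | LinZero
  | LinAdd of lin_expr & lin_expr
  | LinOpp of lin_expr
  | LinScale of K & lin_expr.

Fixpoint lin_eval (s : seq V) (e : lin_expr) : V :=
  match e with
  | LinAtom i => s`_i
  | LinZero => 0
  | LinAdd e1 e2 => lin_eval s e1 + lin_eval s e2
  | LinOpp e1 => - lin_eval s e1
  | LinScale c e1 => c *: lin_eval s e1
  end.

Fixpoint lin_coef (i : nat) (e : lin_expr) : K :=
  match e with
  | LinAtom j => if i == j then 1 else 0
  | LinZero => 0
  | LinAdd e1 e2 => lin_coef i e1 + lin_coef i e2
  | LinOpp e1 => - lin_coef i e1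
  | LinScale c e1 => c * lin_coef i e1
  end.

Fixpoint lin_wf (n : nat) (e : lin_expr) : bool :=
  match e with
  | LinAtom j => (j < n)%N
  | LinZero => true
  | LinAdd e1 e2 => lin_wf n e1 && lin_wf n e2
  | LinOpp e1 => lin_wf n e1
  | LinScale c e1 => lin_wf n e1
  end.

Lemma lin_evalE s e : lin_wf (size s) e ->
  lin_eval s e = \sum_(i < size s) lin_coef i e *: s`_i.
Proof.
elim: e => [j|_|e1 IH1 e2 IH2|e IH|c e IH] /=.
- move=> lj; rewrite (bigD1 (Ordinal lj)) //= eqxx scale1r big1 ?addr0 // => i.
  by rewrite -val_eqE /= => /negPf->; rewrite scale0r.
- by rewrite big1 // => i _; rewrite scale0r.
- case/andP => /IH1-> /IH2->; rewrite -big_split; apply: eq_bigr => i _.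
  by rewrite scalerDl.
- by move/IH->; rewrite -sumrN; apply: eq_bigr => i _; rewrite scaleNr.
by move/IH->; rewrite scaler_sumr; apply: eq_bigr => i _; rewrite scalerA.
Qed.

(** A bounded quantifier that computes to a conjunction, so that [repeat split] leaves one identity
    in K per atom. *)
Fixpoint all_below (n : nat) (P : nat -> Prop) : Prop :=
  if n is m.+1 then all_below m P /\ P m else True.

Lemma lin_eq s e1 e2 :
  lin_wf (size s) e1 -> lin_wf (size s) e2 ->
  all_below (size s) (fun i => lin_coef i e1 = lin_coef i e2) ->
  lin_eval s e1 = lin_eval s e2.
Proof.
move=> w1 w2 H; rewrite !lin_evalE //; apply: eq_bigr => i _; congr (_ *: _).
elim: (size s) i H => [[]//|n IH] [i /= li] [Hn H].
by move: li; rewrite ltnS leq_eqVlt => /orP[/eqP->//|lin]; apply: (IH (Ordinal lin)).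
Qed.

End LinearCombinations.

(* Atoms are compared up to conversion because the same monomial may come with
   different paths of canonical structures. *)
Ltac lin_index a s :=
  match s with
  | ?b :: _ => let u := match goal with _ => unify a b end in constr:(0%N)
  | _ :: ?s' => let i := lin_index a s' in constr:(S i)
  end.

Ltac lin_mem a s :=
  match s with
  | ?b :: _ => let u := match goal with _ => unify a b end in constr:(true)
  | _ :: ?s' => lin_mem a s'
  | _ => constr:(false)
  end.

Ltac lin_atoms t s :=
  match t with
  | (?a + ?b)%R => let s' := lin_atoms a s in lin_atoms b s'
  | (- ?a)%R => lin_atoms a s
  | (?c *: ?a)%R => lin_atoms a s
  | 0%R => s
  | _ => match lin_mem t s with true => s | false => constr:(t :: s) end
  end.

Ltac lin_reify K t s :=
  match t with
  | (?a + ?b)%R =>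
      let a' := lin_reify K a s in let b' := lin_reify K b s in
      constr:(@LinAdd K a' b')
  | (- ?a)%R => let a' := lin_reify K a s in constr:(@LinOpp K a')
  | (?c *: ?a)%R => let a' := lin_reify K a s in constr:(@LinScale K c a')
  | 0%R => constr:(@LinZero K)
  | _ => let i := lin_index t s in constr:(@LinAtom K i)
  end.

Ltac lin_prepare K V :=
  match goal with
  | |- ?l = ?r =>
      let s := lin_atoms l (@nil V) in
      let s := lin_atoms r s in
      let l' := lin_reify K l s in
      let r' := lin_reify K r s in
      apply: (@lin_eq K V s l' r'); [by []|by []|
        rewrite /= ?(mulr0, mulr1, addr0, add0r, oppr0); repeat split]
  end.

Ltac expand_words :=
  rewrite ?(exprS, expr0, mulr1, mul1r);
  rewrite ?(mulrDl, mulrDr, mulNr, mulrN, mulr0, mul0r, scalerDr, scalerN);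
  rewrite -?(scalerAl, scalerAr);
  rewrite ?(mulrDl, mulrDr, mulNr, mulrN, mulr0, mul0r, scalerDr, scalerN);
  rewrite -?(scalerAl, scalerAr);
  rewrite ?(mulrDl, mulrDr, mulNr, mulrN, mulr0, mul0r, scalerDr, scalerN);
  rewrite -?(scalerAl, scalerAr) ?mulrA.

(** * The relations between e1, e2, e3, w, z and z' *)

Section SerreWords.
Variables (K : fieldType) (q : K) (A : algType K) (x y : A).
Hypothesis q0 : q != 0.
Let c := x * y - q ^+ 2 *: (y * x).
Let d := y * c - q ^+ 2 *: (c * y).

(** The Serre relators are iterated q-commutators: the first relation says that c q-commutes with x,
    the second that d commutes with y. *)
Lemma serre1E : serre1 q x y = x * c - q ^- 2 *: (c * x).
Proof.
rewrite /serre1 /c; expand_words.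
lin_prepare K A; by field.
Qed.

Lemma serre2E : q ^+ 2 *: serre2 q x y = d * y - y * d.
Proof.
rewrite /serre2 /d /c; expand_words.
lin_prepare K A; by field.
Qed.

End SerreWords.

Section B2Relations.
Variables (K : fieldType) (q : K) (A : algType K) (x y c w d d' : A).
Hypotheses (q0 : q != 0) (q2 : q ^+ 2 != 1) (q4 : q ^+ 2 != -1).
Hypothesis cE : c = x * y - q ^+ 2 *: (y * x).
Hypothesis dE : d = y * c - q ^+ 2 *: (c * y).
Hypothesis wE : w = y * c - c * y.
Hypothesis d'E : d' = (1 - q ^- 2) *:
  (c * (x * y - q ^- 2 *: (y * x)) + (1 + q ^- 2) *: (d * x)).
Hypothesis serre_x : serre1 q x y = 0.
Hypothesis serre_y : serre2 q x y = 0.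

Let qB1 : q ^+ 2 - 1 != 0. Proof. by rewrite subr_eq0. Qed.
Let qD1 : q ^+ 2 + 1 != 0. Proof. by rewrite addr_eq0. Qed.
Let lin_cancel (a : K) (u v : A) : a != 0 -> a *: u = a *: v -> u = v.
Proof. by move=> a0 /(congr1 ( *:%R a^-1)); rewrite !scalerA mulVf // !scale1r. Qed.

Lemma b2_xy : x * y = q ^+ 2 *: (y * x) + c.
Proof. by rewrite cE addrC subrK. Qed.

Lemma b2_xc : x * c = q ^- 2 *: (c * x).
Proof.
apply/eqP; rewrite -subr_eq0; apply/eqP.
by rewrite cE -(serre1E x y q0).
Qed.

Lemma b2_yd : y * d = d * y.
Proof.
apply/esym/eqP; rewrite -subr_eq0 dE cE; apply/eqP.
by rewrite -(serre2E x y q0) serre_y scaler0.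
Qed.

(** In x d, carry x to the right past y and c; the correction terms c c cancel. *)
Lemma b2_xd : x * d = d * x.
Proof.
have -> : x * d = (x * y) * c - q ^+ 2 *: ((x * c) * y).
  by rewrite dE; expand_words.
rewrite b2_xy b2_xc.
have -> : (q ^+ 2 *: (y * x) + c) * c - q ^+ 2 *: (q ^- 2 *: (c * x) * y) =
    q ^+ 2 *: (y * (x * c)) + c * c - c * (x * y).
  expand_words; lin_prepare K A; by field.
rewrite b2_xy b2_xc dE; expand_words; lin_prepare K A; by field.
Qed.

(** w and d are two independent combinations of y c and c y, as q^2 is not 1; these formulas invert
    them, and in the quantum torus they give y = (q^2 - 1)^-1 c^-1 (w - d). *)
Lemma b2_cy : (q ^+ 2 - 1) *: (c * y) = w - d.
Proof. rewrite wE dE; lin_prepare K A; by field. Qed.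

Lemma b2_yc : (q ^+ 2 - 1) *: (y * c) = q ^+ 2 *: w - d.
Proof. rewrite wE dE; lin_prepare K A; by field. Qed.

Lemma b2_cd : c * d = d * c.
Proof.
rewrite cE mulrBl mulrBr -scalerAl -scalerAr -!mulrA b2_yd b2_xd.
by rewrite !mulrA b2_xd b2_yd.
Qed.

(** Associativity of c y c: both bracketings are evaluated by [b2_cy] and [b2_yc], and the terms in
    d cancel because c commutes with d. The same is done below with y c y. *)
Lemma b2_wc : w * c = q ^+ 2 *: (c * w).
Proof.
have h : c * ((q ^+ 2 - 1) *: (y * c)) = ((q ^+ 2 - 1) *: (c * y)) * c.
  by rewrite -scalerAr -scalerAl mulrA.
move: h; rewrite b2_cy b2_yc => e.
have -> : w * c = (w - d) * c + d * c by rewrite mulrBl subrK.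
by rewrite -e mulrBr b2_cd subrK -scalerAr.
Qed.

Lemma b2_yw : y * w = q ^+ 2 *: (w * y).
Proof.
have h : y * ((q ^+ 2 - 1) *: (c * y)) = ((q ^+ 2 - 1) *: (y * c)) * y.
  by rewrite -scalerAr -scalerAl mulrA.
move: h; rewrite b2_cy b2_yc => e.
have -> : y * w = y * (w - d) + y * d by rewrite mulrBr subrK.
by rewrite e mulrBl b2_yd subrK -scalerAl.
Qed.

Let a := (1 - q ^- 2)^-1 * (1 + q ^- 2)^-1.
Let b := (1 + q ^- 2)^-1.

Let qm : 1 - q ^- 2 != 0.
Proof.
have -> : 1 - q ^- 2 = (q ^+ 2 - 1) / q ^+ 2 by field.
by rewrite mulf_neq0 ?invr_eq0 ?expf_neq0.
Qed.

Let qp : 1 + q ^- 2 != 0.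
Proof.
have -> : 1 + q ^- 2 = (q ^+ 2 + 1) / q ^+ 2 by field.
by rewrite mulf_neq0 ?invr_eq0 ?expf_neq0.
Qed.

(** Expressed through w, the element d' is (1 - q^-2) (c^2 + (1 + q^-2) w x); the constants [a] and
    [b] come from solving this for w x. *)
Lemma b2_wx : w * x = a *: d' - b *: (c * c).
Proof.
have -> : d' = (1 - q ^- 2) *: (c * c + (1 + q ^- 2) *: (w * x)).
  rewrite d'E wE dE b2_xy; congr (_ *: _); expand_words.
  lin_prepare K A; by field.
rewrite /a /b !scalerDr !scalerA; lin_prepare K A; by field; rewrite ?q0 ?qB1 ?qD1.
Qed.

Lemma b2_xw : x * w = a *: d' - (b * q ^- 4) *: (c * c).
Proof.
have -> : x * w = w * x + (1 - q ^- 2) *: (c * c).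
  have -> : x * w = (x * y) * c - (x * c) * y.
    by rewrite wE mulrBr !mulrA.
  rewrite b2_xy b2_xc.
  have -> : (q ^+ 2 *: (y * x) + c) * c - q ^- 2 *: (c * x) * y =
     q ^+ 2 *: (y * (x * c)) + c * c - q ^- 2 *: (c * (x * y)).
    by expand_words.
  rewrite b2_xc b2_xy wE; expand_words; lin_prepare K A; by field.
rewrite b2_wx /b; lin_prepare K A; by field; rewrite ?q0 ?qB1 ?qD1.
Qed.

(** Associativity of x w x: the c^2-terms agree because x c^2 = q^-4 c^2 x, which leaves a x d' = a
    d' x. *)
Lemma b2_xd' : x * d' = d' * x.
Proof.
have a0 : a != 0 by rewrite mulf_neq0 ?invr_eq0.
apply: (lin_cancel a0).
have e1 : x * (w * x) = (x * w) * x by rewrite mulrA.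
move: e1; rewrite b2_wx b2_xw mulrBr mulrBl -!scalerAr -!scalerAl => e.
have -> : a *: (x * d') = a *: (x * d') - b *: (x * (c * c)) + b *: (x * (c * c)).
  by rewrite subrK.
rewrite e.
have -> : x * (c * c) = q ^- 4 *: (c * c * x).
  rewrite mulrA b2_xc -scalerAl -[c * x * c]mulrA b2_xc -scalerAr scalerA mulrA.
  by congr (_ *: _); field.
by rewrite scalerA subrK.
Qed.

Lemma b2_yd' : y * d' = d' * y.
Proof.
have -> : d' = (1 - q ^- 2) *: (c * c + (1 + q ^- 2) *: (w * x)).
  rewrite b2_wx /a /b; lin_prepare K A; by field; rewrite ?q0 ?qB1 ?qD1.
rewrite -scalerAl -scalerAr; congr (_ *: _).
have h : y * w * x = w * (x * y) - w * c.
  by rewrite b2_yw b2_xy mulrDr addrK -scalerAl -scalerAr mulrA.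
rewrite mulrDr mulrDl -scalerAr -scalerAl 2!mulrA h.
have -> : y * c * c = c * c * y + w * c + c * w.
  rewrite wE; expand_words; lin_prepare K A; by field.
rewrite b2_wc; expand_words; lin_prepare K A; by field.
Qed.

End B2Relations.

(** * Induction principles for the free algebra, U and C[z, z'] *)

Lemma ord2P (i : 'I_2) : i = 0 \/ i = 1.
Proof. by case: i => [[|[|[]]]] // lt_i2; [left|right]; apply/val_inj. Qed.

Section FreeAlgebraInduction.
Import monalg.
Variables (K : fieldType) (I : choiceType).

Lemma free_alg_ind (P : free_alg K I -> Prop) :
  P 0 -> P 1 -> (forall (c : K) f g, P f -> P g -> P (c *: f + g)) ->
  (forall i f, P f -> P (free_gen K i * f)) -> forall f, P f.
Proof.
move=> P0 P1 PD PM f; rewrite [f]monalgE.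
elim/big_ind: _ => // [a b Pa Pb|m _]; first by rewrite -[a]scale1r; apply: PD.
move: (X in << X *g _ >>) => c.
have -> : << c *g m >> = c *: (<< m >> : free_alg K I) + 0.
  by rewrite addr0; apply/malgP => k; rewrite mcoeffZ !mcoeffU mulr_natr.
apply: PD => //.
have ->: m = FMonom (fmonom_val m) by case: m.
elim: (fmonom_val m) => [|i s IH]; first by rewrite -fmoneE.
have -> : << FMonom (i :: s) >> =
    free_gen K i * (<< FMonom s >> : free_alg K I).
  rewrite /free_gen [RHS]malgME !msuppU !oner_eq0 /= !finmap.big_seq_fset1.
  by rewrite !mcoeffUU mulr1 -[RHS]/(<< fmmul _ _ >>) fmmulE fmuE.
exact: PM.
Qed.
End FreeAlgebraInduction.

Section UqInduction.
Variables (K : fieldType) (q : K).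

Lemma uqB2_ind (P : uqB2 q -> Prop) :
  P 0 -> P 1 -> (forall (c : K) u v, P u -> P v -> P (c *: u + v)) ->
  (forall u, P u -> P (e1 q * u)) -> (forall u, P u -> P (e2 q * u)) ->
  forall u, P u.
Proof.
move=> P0 P1 PD PX PY u; rewrite -[u]uqB2_reprK; elim/free_alg_ind: (repr u).
- by rewrite raddf0.
- by rewrite rmorph1.
- by move=> c f g Pf Pg; rewrite linearP; apply: PD.
move=> i f Pf; rewrite rmorphM.
have [->|->] := ord2P i.
  exact: PX.
exact: PY.
Qed.

End UqInduction.

Lemma mpoly2_ind (K : fieldType) (P : {mpoly K[2]} -> Prop) :
  P 0 -> P 1 -> (forall (c : K) f g, P f -> P g -> P (c *: f + g)) ->
  (forall i f, P f -> P ('X_i * f)) -> forall f, P f.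
Proof.
move=> P0 P1 PD PX; elim/mpolyind => // c m p _ _ Pp; apply: (PD) => //.
have PXn i n f : P f -> P ('X_i ^+ n * f).
  elim: n => [|n IH] Pf; first by rewrite expr0 mul1r.
  by rewrite exprS -mulrA; apply: PX; apply: IH.
rewrite mpolyXE_id big_ord_recl big_ord_recl big_ord0.
by apply: (PXn); apply: (PXn).
Qed.

(** * Centrality of z and z', and the evaluation of central polynomials *)

Section CentralEvaluation.
Variables (K : fieldType) (q : K).
Hypotheses (q0 : q != 0) (q2 : q ^+ 2 != 1) (q4 : q ^+ 2 != -1).
Local Notation U := (uqB2 q).
Local Notation x := (e1 q).
Local Notation y := (e2 q).
Local Notation c := (e3 q).
Local Notation d := (z q).
Local Notation d' := (z' q).
Local Notation ev := (@eval_zz' K q).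

Definition comm23 : U := e2 q * e3 q - e3 q * e2 q.

Local Notation w := comm23.

(* The constants of w e1 = coefA z' - coefB e3^2. *)
Definition coefA : K := (1 - q ^- 2)^-1 * (1 + q ^- 2)^-1.
Definition coefB : K := (1 + q ^- 2)^-1.

Lemma coefA_neq0 : coefA != 0.
Proof.
rewrite /coefA mulf_neq0 ?invr_eq0 //.
  have -> : 1 - q ^- 2 = (q ^+ 2 - 1) / q ^+ 2 by field.
  by rewrite mulf_neq0 ?invr_eq0 ?expf_neq0 // subr_eq0.
have -> : 1 + q ^- 2 = (q ^+ 2 + 1) / q ^+ 2 by field.
by rewrite mulf_neq0 ?invr_eq0 ?expf_neq0 // addr_eq0.
Qed.

Let sx := uqB2_serre1 q.
Let sy := uqB2_serre2 q.

Lemma xcE : x * c = q ^- 2 *: (c * x).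
Proof. exact: (b2_xc q0 erefl sx). Qed.

Lemma xyE : x * y = q ^+ 2 *: (y * x) + c.
Proof. exact: (b2_xy (c := c) erefl). Qed.

Lemma cyE : (q ^+ 2 - 1) *: (c * y) = w - d.
Proof. exact: (b2_cy (K := K) (q := q) (A := U)). Qed.

Lemma ycE : (q ^+ 2 - 1) *: (y * c) = q ^+ 2 *: w - d.
Proof. exact: (b2_yc (K := K) (q := q) (A := U)). Qed.

Lemma wcE : w * c = q ^+ 2 *: (c * w).
Proof. exact: (b2_wc q0 erefl erefl erefl sx sy). Qed.

Lemma ywE : y * w = q ^+ 2 *: (w * y).
Proof. exact: (b2_yw q0 erefl erefl erefl sy). Qed.

Lemma wxE : w * x = coefA *: d' - coefB *: (c * c).
Proof. exact: (b2_wx (y := y) (d := d) q0 q2 q4 erefl erefl erefl erefl). Qed.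

Lemma xwE : x * w = coefA *: d' - (coefB * q ^- 4) *: (c * c).
Proof. exact: (b2_xw q0 q2 q4 erefl erefl erefl erefl sx). Qed.

Lemma centralP (s : U) : x * s = s * x -> y * s = s * y -> forall u, u * s = s * u.
Proof.
move=> hx hy; elim/uqB2_ind => [||k u v hu hv|u hu|u hu].
- by rewrite mul0r mulr0.
- by rewrite mul1r mulr1.
- by rewrite mulrDl mulrDr -scalerAl -scalerAr hu hv.
- by rewrite -mulrA hu !mulrA hx.
by rewrite -mulrA hu !mulrA hy.
Qed.

Lemma z_central u : u * d = d * u.
Proof.
apply: centralP.
  exact: (b2_xd q0 erefl erefl sx).
exact: (b2_yd q0 erefl erefl sy).
Qed.

Lemma z'_central u : u * d' = d' * u.
Proof.
apply: centralP.
  exact: (b2_xd' q0 q2 q4 erefl erefl erefl erefl sx).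
exact: (b2_yd' q0 q2 q4 erefl erefl erefl erefl sx sy).
Qed.

Lemma evD f g : ev (f + g) = ev f + ev g.
Proof. exact: raddfD. Qed.

Lemma evB f g : ev (f - g) = ev f - ev g.
Proof. exact: raddfB. Qed.

Lemma ev0 : ev 0 = 0.
Proof. exact: raddf0. Qed.

Lemma evZ k f : ev (k *: f) = k *: ev f.
Proof. by rewrite /eval_zz' mmapZ /= mulr_algl. Qed.

Lemma evC k : ev k%:MP = k%:A.
Proof. by rewrite /eval_zz' mmapC. Qed.

Lemma evX i : ev 'X_i = if i == 0 then d else d'.
Proof. by rewrite /eval_zz' mmapX mmap1U. Qed.

Lemma ev_multiplicative : multiplicative ev.
Proof.
apply: commr_mmap_is_multiplicative => [i u|f m m'].
  by case: ifP => _; [apply: z_central|apply: z'_central].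
by rewrite /GRing.comm /= mulr_algl mulr_algr.
Qed.

Lemma evM f g : ev (f * g) = ev f * ev g.
Proof. exact: ev_multiplicative.1. Qed.

Lemma ev1 : ev 1 = 1.
Proof. exact: ev_multiplicative.2. Qed.

Lemma ev_central f u : u * ev f = ev f * u.
Proof.
elim/mpoly2_ind: f u => [||k f g hf hg|i f hf] u.
- by rewrite ev0 mulr0 mul0r.
- by rewrite ev1 mulr1 mul1r.
- by rewrite evD evZ mulrDr mulrDl -scalerAr -scalerAl hf hg.
rewrite evM evX !mulrA -[RHS]mulrA -hf; case: ifP => _.
  by rewrite z_central !mulrA.
by rewrite z'_central !mulrA.
Qed.

End CentralEvaluation.

(** * A spanning family of U over C[z, z'] indexed by pairs of integers *)

Section MonomialSpan.
Variables (K : fieldType) (q alpha beta : K) (A : algType K) (x y c w d d' : A).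
Hypotheses (q0 : q != 0) (q2 : q ^+ 2 != 1).
Hypotheses (xyR : x * y = q ^+ 2 *: (y * x) + c) (xcR : x * c = q ^- 2 *: (c * x)).
Hypothesis cyR : (q ^+ 2 - 1) *: (c * y) = w - d.
Hypothesis ycR : (q ^+ 2 - 1) *: (y * c) = q ^+ 2 *: w - d.
Hypotheses (wcR : w * c = q ^+ 2 *: (c * w)) (ywR : y * w = q ^+ 2 *: (w * y)).
Hypothesis xwR : x * w = alpha *: d' - beta *: (c * c).
Hypotheses (dC : forall u, u * d = d * u) (d'C : forall u, u * d' = d' * u).

(* Indexed so that, inside the quantum torus, the lowest term of the element of
   index (i, j) is a scalar multiple of x^i y^j. *)
Definition basis_w (n : int) : A := match n with Posz k => w ^+ k | Negz k => x ^+ k.+1 end.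
Definition basis_c (n : int) : A := match n with Posz k => c ^+ k | Negz k => y ^+ k.+1 end.
Definition basis (s : int * int) : A := basis_w s.2 * basis_c s.1.

(** The scalar is left unspecified, since its value does not matter for a span. *)
Definition qcommute (u v : A) := exists k, u * v = k *: (v * u).

Lemma qcommuteX u v m n : qcommute u v -> qcommute (u ^+ m) (v ^+ n).
Proof.
move=> quv; have qX (u' v' : A) n' : qcommute u' v' -> qcommute u' (v' ^+ n').
  case=> k e; elim: n' => [|n' [k' IH]]; first by exists 1; rewrite scale1r mulr1 mul1r.
  exists (k' * k); rewrite exprSr mulrA IH -scalerAl -[_ * u' * v']mulrA e.
  by rewrite -scalerAr scalerA mulrA.
apply: qX; elim: m => [|m [k' IH]]; first by exists 1; rewrite scale1r mulr1 mul1r.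
case: quv => k e; exists (k' * k).
by rewrite exprS -[u * _ * _]mulrA IH -scalerAr [u * (v * _)]mulrA e -scalerAl scalerA mulrA.
Qed.

(** The basis elements are the words in which [s] or [k] is zero and [a] or [l] is zero; [monom_cy]
    and [monom_xw] reduce every other word to these. *)
Definition monom (s k a l : nat) : A := x ^+ s * w ^+ k * c ^+ a * y ^+ l.

Let cw : qcommute c w.
Proof. by exists (q ^- 2); rewrite wcR scalerA mulVf ?scale1r // expf_neq0. Qed.

Lemma monom_cy s k a l : exists k1 k2 : K,
  monom s k a.+1 l.+1 = k1 *: monom s k.+1 a l + k2 *: (d * monom s k a l).
Proof.
have [kc ec] := qcommuteX a 1 cw; rewrite !expr1 in ec.
have qB1 : q ^+ 2 - 1 != 0 by rewrite subr_eq0.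
have ecy : c * y = (q ^+ 2 - 1)^-1 *: (w - d).
  by rewrite -cyR scalerA mulVf // scale1r.
exists ((q ^+ 2 - 1)^-1 * kc), (- (q ^+ 2 - 1)^-1).
rewrite /monom exprSr [y ^+ l.+1]exprS.
have -> : x ^+ s * w ^+ k * (c ^+ a * c) * (y * y ^+ l)
   = x ^+ s * w ^+ k * c ^+ a * (c * y) * y ^+ l by rewrite !mulrA.
rewrite ecy -scalerAr -scalerAl mulrBr mulrBl scalerBr; congr (_ + _).
  by rewrite -[_ * _ * w]mulrA ec -scalerAr -scalerAl scalerA [w ^+ k.+1]exprSr !mulrA.
by rewrite scaleNr; congr (- (_ *: _)); rewrite dC !mulrA.
Qed.

Lemma monom_xw s k a l : exists k1 k2 : K,
  monom s.+1 k.+1 a l = k1 *: (d' * monom s k a l) + k2 *: monom s k a.+2 l.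
Proof.
have [kc ec] := qcommuteX 2 k cw.
exists alpha, (- (beta * kc)).
rewrite /monom exprSr [w ^+ k.+1]exprS.
have -> : x ^+ s * x * (w * w ^+ k) = x ^+ s * (x * w) * w ^+ k by rewrite !mulrA.
rewrite xwR -expr2 mulrBr !mulrBl; congr (_ + _).
  by rewrite -!(scalerAl, scalerAr) d'C !mulrA.
rewrite scaleNr; congr (- _).
rewrite -!(scalerAl, scalerAr) -[x ^+ s * c ^+ 2 * _]mulrA ec.
have -> : c ^+ a.+2 = c ^+ 2 * c ^+ a by rewrite -exprD add2n.
by rewrite -!(scalerAl, scalerAr) scalerA !mulrA.
Qed.

Lemma y_xX s : exists k1 k2 : K,
  y * x ^+ s.+1 = k1 *: (x ^+ s.+1 * y) + k2 *: (x ^+ s * c).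
Proof.
have eyx : y * x = q ^- 2 *: (x * y - c).
  by rewrite xyR addrK scalerA mulVf ?scale1r // expf_neq0.
have qcx : qcommute c x.
  by exists (q ^+ 2); rewrite xcR scalerA mulfV ?scale1r // expf_neq0.
elim: s => [|s [k1 [k2 IH]]].
  exists (q ^- 2), (- q ^- 2); rewrite expr0 mul1r expr1 eyx scalerBr scaleNr.
  by [].
have [k e] := qcommuteX 1 s.+1 qcx; rewrite expr1 in e.
exists (q ^- 2 * k1), (q ^- 2 * k2 - q ^- 2 * k).
rewrite [x ^+ s.+2]exprS [y * (x * _)]mulrA eyx -scalerAl mulrBl.
rewrite -[x * y * _]mulrA IH e mulrDr -!scalerAr.
rewrite [x * (x ^+ s * c)]mulrA -exprS [x * (_ * y)]mulrA -exprS.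
by lin_prepare K A; ring.
Qed.

(** [S] stands for the span of the basis over polynomials in d and d'; only closure properties of
    that span enter. *)
Variable S : A -> Prop.
Hypotheses (SD : forall u v, S u -> S v -> S (u + v)) (SZ : forall k u, S u -> S (k *: u)).
Hypotheses (Sd : forall u, S u -> S (d * u)) (Sd' : forall u, S u -> S (d' * u)).
Hypothesis Sbasis : forall s, S (basis s).

Let SB u v : S u -> S v -> S (u - v).
Proof. by move=> su sv; apply: SD => //; rewrite -scaleN1r; apply: SZ. Qed.

(** Induction on [l], then on [s]. Replacing c y lowers [l], with [s] unchanged; replacing x w
    lowers [s] and keeps [l], although it may raise the exponent of c by two. *)
Lemma spanned_monom s k a l : S (monom s k a l).
Proof.
elim: l s k a => [|l IHl] s; elim: s => [|s IHs] k a.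
- have := Sbasis (Posz a, Posz k).
  by rewrite /basis /monom /= expr0 mul1r mulr1.
- case: k => [|k].
    have := Sbasis (Posz a, Negz s).
    by rewrite /basis /monom /= expr0 !mulr1.
  have [k1 [k2 ->]] := monom_xw s k a 0.
  by apply: SD; apply: SZ; [apply: Sd'|]; apply: IHs.
- case: a => [|a]; last first.
    have [k1 [k2 ->]] := monom_cy 0 k a l.
    by apply: SD; apply: SZ; [|apply: Sd]; apply: IHl.
  have := Sbasis (Negz l, Posz k).
  by rewrite /basis /monom /= expr0 mul1r mulr1.
case: a => [|a]; last first.
  have [k1 [k2 ->]] := monom_cy s.+1 k a l.
  by apply: SD; apply: SZ; [|apply: Sd]; apply: IHl.
case: k => [|k].
  have := Sbasis (Negz l, Negz s).
  by rewrite /basis /monom /= expr0 !mulr1.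
have [k1 [k2 ->]] := monom_xw s k 0 l.+1.
by apply: SD; apply: SZ; [apply: Sd'|]; apply: IHs.
Qed.

Lemma spanned_wcy s k a l : S (x ^+ s * (y * w ^+ k) * c ^+ a * y ^+ l).
Proof.
have qyw : qcommute y w by exists (q ^+ 2); rewrite ywR.
have [k1 e] := qcommuteX 1 k qyw; rewrite expr1 in e; rewrite e.
rewrite -!(scalerAr, scalerAl); apply: SZ; rewrite mulrA.
case: a => [|a].
  have := spanned_monom s k 0 l.+1; rewrite /monom exprS !expr0 !mulr1.
  by rewrite mulrA.
rewrite exprS.
have -> : x ^+ s * w ^+ k * y * (c * c ^+ a) * y ^+ l =
    x ^+ s * w ^+ k * (y * c) * c ^+ a * y ^+ l by rewrite !mulrA.
have -> : y * c = (q ^+ 2 - 1)^-1 *: (q ^+ 2 *: w - d).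
  by rewrite -ycR scalerA mulVf ?scale1r // subr_eq0.
rewrite -!(scalerAr, scalerAl); apply: SZ.
rewrite mulrBr !mulrBl; apply: SB.
  rewrite -!(scalerAr, scalerAl); apply: SZ.
  by have := spanned_monom s k.+1 a l; rewrite /monom exprSr !mulrA.
have := Sd (spanned_monom s k a l).
by rewrite /monom dC !mulrA.
Qed.

(** Passing y over the power of x leaves a term with y beyond it and a term with c in its place. In
    the former y moves past w and is absorbed by c or joins the power of y; in the latter c moves
    past w. *)
Lemma spanned_y_monom s k a l : S (y * monom s k a l).
Proof.
rewrite /monom !mulrA; case: s => [|s].
  by have := spanned_wcy 0 k a l; rewrite !expr0 !mulr1 !mul1r.
have [k1 [k2 ->]] := y_xX s.
rewrite !mulrDl; apply: SD; rewrite -!scalerAl; apply: SZ.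
  by have := spanned_wcy s.+1 k a l; rewrite !mulrA.
have [k3 e] := qcommuteX 1 k cw; rewrite expr1 in e.
rewrite -[x ^+ s * c * _]mulrA e -!(scalerAl, scalerAr); apply: SZ.
by have := spanned_monom s k a.+1 l; rewrite /monom exprS !mulrA.
Qed.

Lemma spanned_x_monom s k a l : S (x * monom s k a l).
Proof. by have := spanned_monom s.+1 k a l; rewrite /monom exprS !mulrA. Qed.

Lemma basis_monom s : exists s1 k a l, basis s = monom s1 k a l.
Proof.
case: s => [[a|l] [k|s]]; rewrite /basis /monom /=.
- by exists 0, k, a, 0; rewrite expr0 mul1r mulr1.
- by exists s.+1, 0, a, 0; rewrite expr0 !mulr1.
- by exists 0, k, 0, l.+1; rewrite !expr0 mul1r mulr1.
by exists s.+1, 0, 0, l.+1; rewrite !expr0 !mulr1.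
Qed.

End MonomialSpan.

Section Spanning.
Variables (K : fieldType) (q : K).
Hypotheses (q0 : q != 0) (q2 : q ^+ 2 != 1) (q4 : q ^+ 2 != -1).
Local Notation U := (uqB2 q).
Local Notation ev := (@eval_zz' K q).

Definition uq_basis : int * int -> U := basis (e1 q) (e2 q) (e3 q) (comm23 q).

Definition spanned (u : U) : Prop :=
  exists r : seq ({mpoly K[2]} * (int * int)),
    u = \sum_(t <- r) ev t.1 * uq_basis t.2.

Lemma spanned0 : spanned 0.
Proof. by exists [::]; rewrite big_nil. Qed.

Lemma spannedD u v : spanned u -> spanned v -> spanned (u + v).
Proof. by move=> [r ->] [r' ->]; exists (r ++ r'); rewrite big_cat. Qed.

Lemma spannedM f u : spanned u -> spanned (ev f * u).
Proof.
move=> [r ->]; exists [seq (f * t.1, t.2) | t <- r].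
by rewrite big_map mulr_sumr; apply: eq_bigr => t _; rewrite evM // mulrA.
Qed.

Lemma spannedZ k u : spanned u -> spanned (k *: u).
Proof. by move/(spannedM k%:MP); rewrite evC mulr_algl. Qed.

Lemma spanned_basis s : spanned (uq_basis s).
Proof. by exists [:: (1, s)]; rewrite big_seq1 ev1 // mul1r. Qed.

Lemma spanned_all u : spanned u.
Proof.
have Sd v : spanned v -> spanned (z q * v) by move/(spannedM 'X_0); rewrite evX.
have Sd' v : spanned v -> spanned (z' q * v) by move/(spannedM 'X_1); rewrite evX.
elim/uqB2_ind: u => [||k u v su sv|u [r ->]|u [r ->]].
- exact: spanned0.
- by have := spanned_basis (Posz 0, Posz 0); rewrite /uq_basis /basis /= mulr1.
- by apply: spannedD => //; apply: spannedZ.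
- rewrite mulr_sumr; elim/big_ind: _ => [||t _]; [exact: spanned0|exact: spannedD|].
  rewrite mulrA ev_central // -mulrA; apply: spannedM; rewrite /uq_basis.
  have [s [k [a [l ->]]]] := basis_monom (e1 q) (e2 q) (e3 q) (comm23 q) t.2.
  by apply: (spanned_x_monom q0 q2 (cyE q) (wcE q0) (xwE q0 q2 q4)
    (z_central q0) (z'_central q0 q2 q4) spannedD spannedZ Sd Sd' spanned_basis).
rewrite mulr_sumr; elim/big_ind: _ => [||t _]; [exact: spanned0|exact: spannedD|].
rewrite mulrA ev_central // -mulrA; apply: spannedM; rewrite /uq_basis.
have [s [k [a [l ->]]]] := basis_monom (e1 q) (e2 q) (e3 q) (comm23 q) t.2.
by apply: (spanned_y_monom q0 q2 (xyE q) (xcE q0) (cyE q) (ycE q) (wcE q0)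
  (ywE q0) (xwE q0 q2 q4)
  (z_central q0) (z'_central q0 q2 q4) spannedD spannedZ Sd Sd' spanned_basis).
Qed.

End Spanning.

(** * The algebra of linear endomorphisms, as a target for [free_eval] *)

Section EndomorphismAlgebra.
Variables (K : fieldType) (V : lmodType K).

Record endo := Endo { endo_fun :> V -> V; endo_linear : linear endo_fun }.

Implicit Types f g h : endo.

Lemma endo_ext f g : (forall v, f v = g v) -> f = g.
Proof.
case: f g => [f fl] [g gl] /= /funext fg.
by case: _ / fg in gl *; congr Endo; apply: Prop_irrelevance.
Qed.

HB.instance Definition _ := gen_eqMixin endo.
HB.instance Definition _ := gen_choiceMixin endo.

Lemma endoP f k u v : f (k *: u + v) = k *: f u + f v.
Proof. exact: endo_linear. Qed.

Fact endo_zero_linear : linear (fun _ : V => 0 : V).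
Proof. by move=> k u v; rewrite scaler0 addr0. Qed.

Fact endo_opp_linear f : linear (fun v => - f v).
Proof. by move=> k u v; rewrite endoP opprD scalerN. Qed.

Fact endo_add_linear f g : linear (fun v => f v + g v).
Proof. by move=> k u v; rewrite !endoP scalerDr addrACA. Qed.

Fact endo_mul_linear f g : linear (fun v => f (g v)).
Proof. by move=> k u v; rewrite !endoP. Qed.

Fact endo_one_linear : linear (fun v : V => v).
Proof. by []. Qed.

Fact endo_scale_linear k f : linear (fun v => k *: f v).
Proof. by move=> k' u v; rewrite endoP scalerDr !scalerA mulrC. Qed.

Definition endo_zero := Endo endo_zero_linear.
Definition endo_opp f := Endo (endo_opp_linear f).
Definition endo_add f g := Endo (endo_add_linear f g).
Definition endo_mul f g := Endo (endo_mul_linear f g).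
Definition endo_one := Endo endo_one_linear.
Definition endo_scale k f := Endo (endo_scale_linear k f).

Fact endo_addA : associative endo_add.
Proof. by move=> f g h; apply: endo_ext => v /=; rewrite addrA. Qed.
Fact endo_addC : commutative endo_add.
Proof. by move=> f g; apply: endo_ext => v /=; rewrite addrC. Qed.
Fact endo_add0 : left_id endo_zero endo_add.
Proof. by move=> f; apply: endo_ext => v /=; rewrite add0r. Qed.
Fact endo_addN : left_inverse endo_zero endo_opp endo_add.
Proof. by move=> f; apply: endo_ext => v /=; rewrite addNr. Qed.

HB.instance Definition _ :=
  GRing.isZmodule.Build endo endo_addA endo_addC endo_add0 endo_addN.

End EndomorphismAlgebra.

Section EndomorphismRing.
Variables (K : fieldType) (V : lmodType K) (v0 : V) (v0_neq0 : v0 != 0).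

(* Nontriviality of V is carried by the type, as required of a nzRingType. *)
Definition endo_ring (v0_neq0 : v0 != 0) := endo V.
Local Notation E := (endo_ring v0_neq0).
HB.instance Definition _ := GRing.Zmodule.on E.

Fact endo_mulA : associative (@endo_mul K V : E -> E -> E).
Proof. by move=> f g h; apply: endo_ext. Qed.
Fact endo_mul1 : left_id (@endo_one K V : E) (@endo_mul K V : E -> E -> E).
Proof. by move=> f; apply: endo_ext. Qed.
Fact endo_mulr1 : right_id (@endo_one K V : E) (@endo_mul K V : E -> E -> E).
Proof. by move=> f; apply: endo_ext. Qed.
Fact endo_mulDl : left_distributive (@endo_mul K V : E -> E -> E) +%R.
Proof. by move=> f g h; apply: endo_ext. Qed.
Fact endo_mulDr : right_distributive (@endo_mul K V : E -> E -> E) +%R.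
Proof.
move=> f g h; apply: endo_ext => v /=.
by have := endoP f 1 (g v) (h v); rewrite !scale1r.
Qed.
Fact endo_one_neq0 : (@endo_one K V : E) != 0.
Proof.
apply: contraNneq v0_neq0 => /(congr1 (fun f : endo V => f v0)) /= ->.
by [].
Qed.

HB.instance Definition _ := GRing.Zmodule_isNzRing.Build E
  endo_mulA endo_mul1 endo_mulr1 endo_mulDl endo_mulDr endo_one_neq0.

Fact endo_scaleA k l (f : E) : endo_scale k (endo_scale l f) = endo_scale (k * l) f.
Proof. by apply: endo_ext => v /=; rewrite scalerA. Qed.
Fact endo_scale1 : left_id 1 (@endo_scale K V : K -> E -> E).
Proof. by move=> f; apply: endo_ext => v /=; rewrite scale1r. Qed.
Fact endo_scaleDr : right_distributive (@endo_scale K V : K -> E -> E) +%R.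
Proof. by move=> k f g; apply: endo_ext => v /=; rewrite scalerDr. Qed.
Fact endo_scaleDl (f : E) : {morph (@endo_scale K V : K -> E -> E)^~ f : k l / k + l}.
Proof. by move=> k l; apply: endo_ext => v /=; rewrite scalerDl. Qed.

HB.instance Definition _ := GRing.Zmodule_isLmodule.Build K E
  endo_scaleA endo_scale1 endo_scaleDr endo_scaleDl.

Fact endo_scaleAl k (f g : E) : k *: (f * g) = (k *: f) * g.
Proof. by apply: endo_ext. Qed.
HB.instance Definition _ := GRing.Lmodule_isLalgebra.Build K E endo_scaleAl.

Fact endo_scaleAr k (f g : E) : k *: (f * g) = f * (k *: g).
Proof.
apply: endo_ext => v /=; have f0 : f 0 = 0.
  by have := endoP f (-1) 0 0; rewrite !scaleN1r !addNr.
by have := endoP f k (g v) 0; rewrite f0 !addr0.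
Qed.
HB.instance Definition _ := GRing.Lalgebra_isAlgebra.Build K E endo_scaleAr.

Lemma endoD (f g : E) v : (f + g : E) v = f v + g v. Proof. by []. Qed.
Lemma endoN (f : E) v : (- f : E) v = - f v. Proof. by []. Qed.
Lemma endoM (f g : E) v : (f * g : E) v = f (g v). Proof. by []. Qed.
Lemma endoZ k (f : E) v : (k *: f : E) v = k *: f v. Proof. by []. Qed.
Lemma endo1 v : (1 : E) v = v. Proof. by []. Qed.
Lemma endo0 v : (0 : E) v = 0. Proof. by []. Qed.

End EndomorphismRing.

(** * The action of U on the quantum torus and the expansion theta *)

Section TorusRepresentation.
Variables (K : fieldType) (q : K).
Hypotheses (q0 : q != 0) (q2 : q ^+ 2 != 1) (q4 : q ^+ 2 != -1).
Local Notation U := (uqB2 q).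
Local Notation Z := {mpoly K[2]}.
Local Notation ev := (@eval_zz' K q).
Local Notation qq := (q ^+ 2).
Local Notation alpha := (coefA q).
Local Notation beta := (coefB q).

(* t : torus_fun stands for the formal sum of the t (i, j) x^i y^j, where
   y x = q^2 x y. *)
Definition torus_fun : Type := int * int -> Z.
HB.instance Definition _ := GRing.Lmodule.on torus_fun.

Implicit Types t : torus_fun.

Lemma torus_funD t t' s : (t + t') s = t s + t' s. Proof. by []. Qed.
Lemma torus_fun0 s : (0 : torus_fun) s = 0. Proof. by []. Qed.
Lemma torus_funN t s : (- t) s = - t s. Proof. by []. Qed.
Lemma torus_funZ k t s : (k *: t) s = k *: t s. Proof. by []. Qed.

Definition torus_delta (s : int * int) : torus_fun := fun r => (r == s)%:R.

Lemma torus_delta_neq0 : torus_delta (0, 0) != 0.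
Proof.
apply/eqP => /(congr1 (fun t => t (0, 0))); rewrite /torus_delta eqxx.
exact/eqP/oner_neq0.
Qed.

Local Notation E := (endo_ring torus_delta_neq0).

Let qq0 : qq != 0. Proof. by rewrite expf_neq0. Qed.
Let qB1 : qq - 1 != 0. Proof. by rewrite subr_eq0. Qed.
Let qD1 : qq + 1 != 0. Proof. by rewrite addr_eq0. Qed.

(** Left multiplication by y sends x^i y^(j-1) to q^(2i) x^i y^j. So w^-1 shifts j by one and
    contributes q^(-2i); it is applied to alpha z' - beta c^2. In [torus_e2] the shift c^-1 is
    applied to (q^2 - 1)^-1 (w - z). *)
Definition torus_e1 t : torus_fun := fun s =>
  qq ^ (- s.1) *: (alpha *: ('X_1 * t (s.1, s.2 + 1)) - beta *: t (s.1 - 2, s.2 + 1)).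

Definition torus_e2 t : torus_fun := fun s =>
  (qq - 1)^-1 *: (qq ^ (s.1 + 1) *: t (s.1 + 1, s.2 - 1) - 'X_0 * t (s.1 + 1, s.2)).

Fact torus_e1_linear : linear torus_e1.
Proof.
move=> k t t'; apply/funext => s.
rewrite /torus_e1 !(torus_funD, torus_funZ) mulrDr -scalerAr.
lin_prepare K {mpoly K[2]}; by ring.
Qed.

Fact torus_e2_linear : linear torus_e2.
Proof.
move=> k t t'; apply/funext => s.
rewrite /torus_e2 !(torus_funD, torus_funZ) mulrDr -scalerAr.
lin_prepare K {mpoly K[2]}; by ring.
Qed.

Definition torus_E1 : E := Endo torus_e1_linear.
Definition torus_E2 : E := Endo torus_e2_linear.

Lemma torus_E1E t i j : torus_E1 t (i, j) =
  qq ^ (- i) *: (alpha *: ('X_1 * t (i, j + 1)) - beta *: t (i - 2, j + 1)).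
Proof. by []. Qed.

Lemma torus_E2E t i j : torus_E2 t (i, j) =
  (qq - 1)^-1 *: (qq ^ (i + 1) *: t (i + 1, j - 1) - 'X_0 * t (i + 1, j)).
Proof. by []. Qed.

(** This validates the choice of the two operators: in their q-commutator all terms in z and z'
    cancel and left multiplication by x remains. Both Serre relations then reduce to q-commutations
    with explicit shifts. *)
Lemma torus_E3E t i j :
  (torus_E1 * torus_E2 - qq *: (torus_E2 * torus_E1) : E) t (i, j) = t (i - 1, j).
Proof.
rewrite endoD torus_funD endoN torus_funN endoZ torus_funZ !endoM.
rewrite !(torus_E1E, torus_E2E).
have -> : i - 2 + 1 = i - 1 by lia.
have -> : i + 1 - 2 = i - 1 by lia.
rewrite !addrK ?subrK opprD !expfzDr // !expr1z.
rewrite -!scalerAr !mulrDr !mulrN -!scalerAr.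
have -> : 'X_0 * ('X_1 * t (i + 1, j + 1)) = 'X_1 * ('X_0 * t (i + 1, j + 1)) by rewrite mulrCA.
rewrite /coefA /coefB.
rewrite -[qq ^ (- i)]invr_expz -[_ ^ (-1)]/(qq^-1).
have := expfz_neq0 i qq0; set Q := _ ^ i => Q0.
by lin_prepare K {mpoly K[2]}; field; rewrite ?q0 ?qB1 ?qD1 ?Q0.
Qed.

Definition torus_C : E := torus_E1 * torus_E2 - qq *: (torus_E2 * torus_E1).
Definition torus_D : E := torus_E2 * torus_C - qq *: (torus_C * torus_E2).
Definition torus_W : E := torus_E2 * torus_C - torus_C * torus_E2.

Lemma torus_CE t i j : torus_C t (i, j) = t (i - 1, j).
Proof. exact: torus_E3E. Qed.

Lemma torus_DE t i j : torus_D t (i, j) = 'X_0 * t (i, j).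
Proof.
rewrite endoD torus_funD endoN torus_funN endoZ torus_funZ !endoM.
rewrite torus_E2E !torus_CE torus_E2E addrK subrK !expfzDr // !expr1z.
by lin_prepare K {mpoly K[2]}; field.
Qed.

Lemma torus_WE t i j : torus_W t (i, j) = qq ^ i *: t (i, j - 1).
Proof.
rewrite endoD torus_funD endoN torus_funN !endoM.
rewrite torus_E2E !torus_CE torus_E2E addrK subrK !expfzDr // !expr1z.
by lin_prepare K {mpoly K[2]}; field.
Qed.

Lemma torus_serre1 : serre1 q torus_E1 torus_E2 = 0.
Proof.
rewrite serre1E // -/torus_C; apply: endo_ext => t; apply/funext => -[i j].
rewrite endoD torus_funD endoN torus_funN endoZ torus_funZ !endoM.
rewrite torus_E1E !torus_CE torus_E1E endo0 torus_fun0.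
have -> : - (i - 1) = - i + 1 by lia.
have -> : i - 1 - 2 = i - 2 - 1 by lia.
rewrite expfzDr // expr1z.
by lin_prepare K {mpoly K[2]}; field.
Qed.

Lemma torus_serre2 : serre2 q torus_E1 torus_E2 = 0.
Proof.
suff e : qq *: serre2 q torus_E1 torus_E2 = 0.
  by rewrite -[LHS]scale1r -(mulVf qq0) -scalerA e scaler0.
rewrite serre2E // -/torus_C -/torus_D; apply: endo_ext => t; apply/funext => -[i j].
rewrite endoD torus_funD endoN torus_funN !endoM torus_DE !torus_E2E !torus_DE endo0 torus_fun0.
apply/eqP; rewrite subr_eq0 -scalerAr; apply/eqP; congr (_ *: _).
by rewrite mulrBr -scalerAr.
Qed.

Definition torus_gens (i : 'I_2) : E := if i == 0 then torus_E1 else torus_E2.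

(* The left regular representation of U inside the quantum torus. *)
Definition act (u : U) : torus_fun -> torus_fun := (free_eval torus_gens (repr u) : E).

Lemma act_pi f : act (uqB2_pi q f) = (free_eval torus_gens f : E).
Proof.
suff e : free_eval torus_gens (repr (uqB2_pi q f)) = free_eval torus_gens f :> E.
  by rewrite /act e.
apply/eqP; rewrite -subr_eq0 -rmorphB /=; apply/eqP.
apply: (serre_ideal_eval (q := q)); last by apply/uqB2_piP; rewrite uqB2_reprK.
  exact: torus_serre1.
exact: torus_serre2.
Qed.

Lemma act_linear u k t t' : act u (k *: t + t') = k *: act u t + act u t'.
Proof. exact: endoP. Qed.

Lemma actD u v t : act (u + v) t = act u t + act v t.
Proof.
by rewrite -[u]uqB2_reprK -[v]uqB2_reprK -raddfD !act_pi rmorphD endoD.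
Qed.

Lemma actZ k u t : act (k *: u) t = k *: act u t.
Proof. by rewrite -[u]uqB2_reprK -linearZ !act_pi linearZ endoZ. Qed.

Lemma act0 t : act 0 t = 0.
Proof. by rewrite -(scale0r (0 : U)) actZ scale0r. Qed.

Lemma actN u t : act (- u) t = - act u t.
Proof. by rewrite -scaleN1r actZ scaleN1r. Qed.

Lemma actM u v t : act (u * v) t = act u (act v t).
Proof.
by rewrite -[u]uqB2_reprK -[v]uqB2_reprK -[_ * _]rmorphM !act_pi rmorphM endoM.
Qed.

Lemma act1 t : act 1 t = t.
Proof. by rewrite -(rmorph1 (uqB2_pi q)) act_pi rmorph1 endo1. Qed.

Lemma act_e1 t : act (e1 q) t = torus_E1 t.
Proof. by rewrite act_pi free_evalU. Qed.

Lemma act_e2 t : act (e2 q) t = torus_E2 t.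
Proof. by rewrite act_pi free_evalU. Qed.

Lemma act_e3 t i j : act (e3 q) t (i, j) = t (i - 1, j).
Proof.
by rewrite /e3 actD actN actZ !actM !act_e1 !act_e2 -torus_CE.
Qed.

Lemma act_e3E t : act (e3 q) t = torus_C t.
Proof. by apply/funext => -[i j]; rewrite act_e3 torus_CE. Qed.

Lemma act_w t i j : act (comm23 q) t (i, j) = qq ^ i *: t (i, j - 1).
Proof.
by rewrite /comm23 actD actN !actM !act_e3E !act_e2 -torus_WE.
Qed.

Lemma act_z t i j : act (z q) t (i, j) = 'X_0 * t (i, j).
Proof.
by rewrite /z actD actN actZ !actM !act_e3E !act_e2 -torus_DE.
Qed.

Lemma act_z' t i j : act (z' q) t (i, j) = 'X_1 * t (i, j).
Proof.
have a0 := coefA_neq0 q0 q2 q4.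
have ed : alpha *: z' q = comm23 q * e1 q + beta *: (e3 q * e3 q).
  by rewrite wxE // subrK.
have : act (alpha *: z' q) t (i, j) = alpha *: ('X_1 * t (i, j)).
  rewrite ed actD torus_funD actZ torus_funZ !actM act_w !act_e3 act_e1 torus_E1E.
  rewrite subrK scalerA -invr_expz mulfV ?expfz_neq0 // scale1r.
  have -> : i - 1 - 1 = i - 2 by lia.
  by rewrite subrK.
rewrite actZ torus_funZ => /(congr1 ( *:%R alpha^-1)).
by rewrite !scalerA mulVf // !scale1r.
Qed.

Lemma act_ev f t s : act (ev f) t s = f * t s.
Proof.
elim/mpoly2_ind: f t s => [||k f g hf hg|i f hf] t [m n].
- by rewrite ev0 act0 mul0r.
- by rewrite ev1 // act1 mul1r.
- by rewrite evD evZ actD actZ torus_funD torus_funZ hf hg mulrDl -scalerAl.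
have [->|->] := ord2P i.
  by rewrite evM // evX actM act_z hf mulrA.
by rewrite evM // evX actM act_z' hf mulrA.
Qed.

Definition cmul (f : Z) t : torus_fun := fun s => f * t s.

(* Right multiplication by x^(r.1) y^(r.2) on formal sums. *)
Definition rmul (r : int * int) t : torus_fun :=
  fun s => qq ^ ((s.2 - r.2) * r.1) *: t (s.1 - r.1, s.2 - r.2).

(** Applied to multiplication by central polynomials and to right multiplication by monomials, which
    together determine [theta] on products. *)
Lemma act_commute (h : torus_fun -> torus_fun) :
  (forall k t t', h (k *: t + t') = k *: h t + h t') ->
  (forall t, torus_E1 (h t) = h (torus_E1 t)) ->
  (forall t, torus_E2 (h t) = h (torus_E2 t)) ->
  forall u t, act u (h t) = h (act u t).
Proof.
move=> hl h1 h2.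
have h0 : h 0 = 0 by have := hl (-1) 0 0; rewrite !scaleN1r !addNr.
elim/uqB2_ind => [||k u v hu hv|u hu|u hu] t.
- by rewrite !act0 h0.
- by rewrite !act1.
- by rewrite !actD !actZ hu hv hl.
- by rewrite !actM !act_e1 hu h1.
by rewrite !actM !act_e2 hu h2.
Qed.

Lemma act_cmul u f t : act u (cmul f t) = cmul f (act u t).
Proof.
apply: (act_commute (h := cmul f)) => [k t1 t2|t1|t1]; apply/funext => -[i j].
- by rewrite torus_funD torus_funZ /cmul torus_funD torus_funZ mulrDr -scalerAr.
- by rewrite /cmul !torus_E1E -!scalerAr mulrBr -!scalerAr !(mulrCA f).
by rewrite /cmul !torus_E2E -!scalerAr mulrBr -!scalerAr !(mulrCA f).
Qed.

Lemma act_rmul u r t : act u (rmul r t) = rmul r (act u t).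
Proof.
case: r => k l.
apply: (act_commute (h := rmul (k, l))) => [c t1 t2|t1|t1]; apply/funext => -[i j].
- rewrite torus_funD torus_funZ /rmul torus_funD torus_funZ scalerDr !scalerA.
  by rewrite mulrC.
- rewrite torus_E1E /rmul torus_E1E /=.
  have -> : j + 1 - l = j - l + 1 by lia.
  have -> : i - 2 - k = i - k - 2 by lia.
  have -> : (j - l + 1) * k = (j - l) * k + k by ring.
  have -> : - (i - k) = - i + k by lia.
  rewrite !expfzDr // -scalerAr.
  by lin_prepare K {mpoly K[2]}; ring.
rewrite torus_E2E /rmul torus_E2E /=.
have -> : j - 1 - l = j - l - 1 by lia.
have -> : i + 1 - k = i - k + 1 by lia.
have -> : (j - l - 1) * k = (j - l) * k - k by ring.
have -> : i + 1 = (i - k + 1) + k by lia.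
rewrite [_ ^ (_ + k)]expfzDr // [_ ^ (_ - k)]expfzDr // -[_ ^ (- k)]invr_expz -scalerAr.
have := expfz_neq0 k qq0; set Q := qq ^ k => Q0.
lin_prepare K {mpoly K[2]}; field; by rewrite ?q0 ?qB1 ?Q0.
Qed.

Definition theta (u : U) : torus_fun := act u (torus_delta (0, 0)).

Definition supported t (r : seq (int * int)) := forall s, s \notin r -> t s = 0.

Lemma supported_act u t r : supported t r -> exists r', supported (act u t) r'.
Proof.
elim/uqB2_ind: u t r => [||k u v hu hv|u hu|u hu] t r tr.
- by exists [::] => s _; rewrite act0.
- by exists r => s; rewrite act1; apply: tr.
- have [r1 h1] := hu _ _ tr; have [r2 h2] := hv _ _ tr.
  exists (r1 ++ r2) => s; rewrite mem_cat negb_or => /andP[s1 s2].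
  by rewrite actD actZ torus_funD torus_funZ h1 // h2 // scaler0 addr0.
- have [r1 h1] := hu _ _ tr.
  exists ([seq (s.1, s.2 - 1) | s <- r1] ++ [seq (s.1 + 2, s.2 - 1) | s <- r1]).
  case=> i j; rewrite mem_cat negb_or actM act_e1 torus_E1E => /andP[n1 n2].
  rewrite !h1 ?mulr0 ?scaler0 ?subr0 ?scaler0 //.
    by apply: contra n2 => n2; apply/mapP; exists (i - 2, j + 1); rewrite //= ?addrK ?subrK.
  by apply: contra n1 => n1; apply/mapP; exists (i, j + 1); rewrite //= ?addrK.
have [r1 h1] := hu _ _ tr.
exists ([seq (s.1 - 1, s.2 + 1) | s <- r1] ++ [seq (s.1 - 1, s.2) | s <- r1]).
case=> i j; rewrite mem_cat negb_or actM act_e2 torus_E2E => /andP[n1 n2].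
rewrite !h1 ?mulr0 ?scaler0 ?subr0 ?scaler0 //.
  by apply: contra n2 => n2; apply/mapP; exists (i + 1, j); rewrite //= ?addrK.
by apply: contra n1 => n1; apply/mapP; exists (i + 1, j - 1); rewrite //= ?addrK ?subrK.
Qed.

Lemma theta_supported u : exists2 r, uniq r & supported (theta u) r.
Proof.
have [|r hr] := @supported_act u (torus_delta (0, 0)) [:: (0, 0)].
  by move=> s; rewrite inE /torus_delta => /negPf->.
exists (undup r); first exact: undup_uniq.
by move=> s; rewrite mem_undup; apply: hr.
Qed.

Lemma act_sum u (I : Type) (r : seq I) (F : I -> torus_fun) s :
  act u (\sum_(i <- r) F i) s = \sum_(i <- r) act u (F i) s.
Proof.
have a0 : act u 0 = 0 by have := act_linear u (-1) 0 0; rewrite !scaleN1r !addNr.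
elim: r => [|i r IH]; first by rewrite !big_nil a0.
by rewrite !big_cons -IH -[F i]scale1r act_linear torus_funD torus_funZ !scale1r.
Qed.

(** The product of the quantum torus: [theta v] is a sum of right multiples of the unit, with which
    the action of u commutes. The power of q^2 comes from carrying y^(j - s.2) across x^(s.1). *)
Lemma theta_mul u v r i j : uniq r -> supported (theta v) r ->
  theta (u * v) (i, j) = \sum_(s <- r)
    theta v s * (qq ^ ((j - s.2) * s.1) *: theta u (i - s.1, j - s.2)).
Proof.
move=> ur hr; rewrite {1}/theta actM -/(theta v).
have e : theta v = \sum_(s <- r) cmul (theta v s) (rmul s (torus_delta (0, 0))).
  apply/funext => s; rewrite fct_sumE.
  have rdE r0 s0 : rmul r0 (torus_delta (0, 0)) s0 = (s0 == r0)%:R.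
    case: r0 s0 => [k l] [m n]; rewrite /rmul /torus_delta /= !xpair_eqE !subr_eq0.
    case: (n =P l) => [->|_]; last by rewrite andbF scaler0.
    by rewrite subrr mul0r expr0z scale1r.
  have [sr|sr] := boolP (s \in r); last first.
    rewrite hr // big_seq big1 // => s0 s0r; rewrite /cmul rdE.
    by case: eqP => [e|_]; [rewrite e s0r in sr | rewrite mulr0].
  rewrite (bigD1_seq s) //= big1 => [|s0 s0s]; first by rewrite /cmul rdE eqxx mulr1 addr0.
  by rewrite /cmul rdE eq_sym (negPf s0s) mulr0.
rewrite [in LHS]e act_sum; apply: eq_bigr => s _.
by rewrite act_cmul act_rmul.
Qed.

Lemma theta_ev f u s : theta (ev f * u) s = f * theta u s.
Proof. by rewrite /theta actM act_ev. Qed.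

Lemma theta_rmul_w u i j : theta (u * comm23 q) (i, j) = theta u (i, j - 1).
Proof.
have e : act (comm23 q) (torus_delta (0, 0)) = rmul (0, 1) (torus_delta (0, 0)).
  apply/funext => -[m n]; rewrite act_w /rmul /torus_delta /= subr0 mulr0 expr0z scale1r.
  rewrite !xpair_eqE; case: (m =P 0) => [->|_]; last by rewrite scaler0.
  by rewrite expr0z scale1r.
by rewrite /theta actM e act_rmul /rmul /= mulr0 expr0z scale1r subr0.
Qed.

Lemma theta_rmul_e3 u i j : theta (u * e3 q) (i, j) = qq ^ j *: theta u (i - 1, j).
Proof.
have e : act (e3 q) (torus_delta (0, 0)) = rmul (1, 0) (torus_delta (0, 0)).
  apply/funext => -[m n]; rewrite act_e3 /rmul /torus_delta /= subr0 mulr1.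
  rewrite !xpair_eqE; case: (n =P 0) => [->|_]; last by rewrite andbF scaler0.
  by rewrite expr0z scale1r.
by rewrite /theta actM e act_rmul /rmul /= mulr1 subr0.
Qed.

End TorusRepresentation.

(** * Trading w for z' and e3 for z inside an ideal *)

Section IdealMonomials.
Variables (K : fieldType) (q alpha beta : K) (A : algType K) (x y c w d d' : A).
Hypotheses (q0 : q != 0) (qn1 : forall n, (0 < n)%N -> q ^+ n != 1) (alpha0 : alpha != 0).
Hypothesis xcR : x * c = q ^- 2 *: (c * x).
Hypothesis cyR : (q ^+ 2 - 1) *: (c * y) = w - d.
Hypothesis ycR : (q ^+ 2 - 1) *: (y * c) = q ^+ 2 *: w - d.
Hypothesis wcR : w * c = q ^+ 2 *: (c * w).
Hypothesis xwR : x * w = alpha *: d' - (beta * q ^- 4) *: (c * c).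
Hypothesis wxR : w * x = alpha *: d' - beta *: (c * c).
Hypotheses (dC : forall u, u * d = d * u) (d'C : forall u, u * d' = d' * u).
Variable I : set A.
Hypothesis idI : two_sided_ideal I.

Let ID u v : I u -> I v -> I (u + v). Proof. by case: idI => _ h _; apply: h. Qed.
Let IZ k u : I u -> I (k *: u).
Proof. by case: idI => _ _ h /(h k%:A 1); rewrite mulr1 mulr_algl. Qed.
Let IMl u v : I v -> I (u * v).
Proof. by case: idI => _ _ h /(h u 1); rewrite mulr1. Qed.
Let IMr u v : I u -> I (u * v).
Proof. by case: idI => _ _ h /(h 1 v); rewrite mul1r. Qed.

Lemma qcomm_powers (u v : A) (k : K) n : u * v = k *: (v * u) ->
  u * v ^+ n = k ^+ n *: (v ^+ n * u) /\ u ^+ n * v = k ^+ n *: (v * u ^+ n).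
Proof.
move=> e; elim: n => [|n [IH1 IH2]].
  by rewrite !expr0 !mulr1 !mul1r !scale1r.
split.
  rewrite [v ^+ n.+1]exprS mulrA e -scalerAl -[v * u * _]mulrA IH1.
  by rewrite -scalerAr scalerA mulrA [k ^+ n.+1]exprS.
rewrite [u ^+ n.+1]exprSr -[u ^+ n * u * v]mulrA e -scalerAr.
by rewrite [_ * (v * u)]mulrA IH2 -scalerAl scalerA -[v * _ * u]mulrA [k ^+ n.+1]exprS.
Qed.

(** Up to scalars, x u and u x are both combinations of d' g and the same h, with different
    coefficients at h. Eliminating h leaves d' g times alpha (q^(4n) - q^(-4)), which vanishes only
    if q^(4n+4) = 1. *)
Lemma ideal_monomial_w m n : I (c ^+ m * w ^+ n.+1) -> I (d' * (c ^+ m * w ^+ n)).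
Proof.
move=> Iu; set u := _ * _ in Iu; set g := c ^+ m * w ^+ n.
pose h := c ^+ m * (c * c) * w ^+ n.
have q2m : q ^- 2 ^+ m != 0 by rewrite expf_neq0 ?invr_eq0 ?expf_neq0.
have e1 : (q ^- 2 ^+ m)^-1 *: (x * u) = alpha *: (d' * g) - (beta * q ^- 4) *: h.
  have [e _] := qcomm_powers m xcR.
  rewrite /u [w ^+ n.+1]exprS mulrA e -scalerAl scalerA mulVf // scale1r.
  have -> : c ^+ m * x * (w * w ^+ n) = c ^+ m * (x * w) * w ^+ n by rewrite !mulrA.
  by rewrite xwR mulrBr mulrBl -!(scalerAl, scalerAr) d'C -[d' * _ * _]mulrA.
have e2 : u * x = alpha *: (d' * g) - (beta * (q ^+ 2 ^+ n * q ^+ 2 ^+ n)) *: h.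
  rewrite /u [w ^+ n.+1]exprSr mulrA -[_ * w * x]mulrA wxR mulrBr -!scalerAr d'C.
  congr (_ - _); rewrite -[RHS]scalerA; congr (_ *: _).
  have [_ e] := qcomm_powers n wcR.
  rewrite -mulrA [w ^+ n * (c * c)]mulrA e -scalerAl -[c * w ^+ n * c]mulrA e.
  by rewrite -!scalerAr scalerA /h !mulrA.
have k0 : alpha * (q ^+ 2 ^+ n * q ^+ 2 ^+ n - q ^- 4) != 0.
  rewrite mulf_neq0 // subr_eq0; apply: contraNneq (qn1 (n := 4 * n + 4) _); last by lia.
  move=> e; rewrite exprD mulnC.
  have -> : q ^+ (n * 4) = q ^- 4.
    by rewrite -e -!exprM -exprD; congr (_ ^+ _); lia.
  by rewrite mulVf // expf_neq0.
have := ID (IZ (q ^+ 2 ^+ n * q ^+ 2 ^+ n) (IZ (q ^- 2 ^+ m)^-1 (IMl x Iu)))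
  (IZ (- q ^- 4) (IMr x Iu)).
rewrite e1 e2.
set e3 := (X in I X -> _).
have -> : e3 = (alpha * (q ^+ 2 ^+ n * q ^+ 2 ^+ n - q ^- 4)) *: (d' * g).
  rewrite /e3; lin_prepare K A; by ring.
by move/(IZ (alpha * (q ^+ 2 ^+ n * q ^+ 2 ^+ n - q ^- 4))^-1); rewrite scalerA mulVf // scale1r.
Qed.

(** Here y u and u y are combinations of c^m w and d c^m; eliminating c^m w leaves d c^m times
    q^(2m+2) - 1. *)
Lemma ideal_monomial_c m : I (c ^+ m.+1) -> I (d * c ^+ m).
Proof.
move=> Iu; set u := _ ^+ _ in Iu.
have [e _] := qcomm_powers m wcR.
have e1 : (q ^+ 2 - 1) *: (y * u) = (q ^+ 2 * q ^+ 2 ^+ m) *: (c ^+ m * w) - d * c ^+ m.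
  by rewrite /u [c ^+ m.+1]exprS mulrA scalerAl ycR mulrBl -scalerAl e scalerA.
have e2 : (q ^+ 2 - 1) *: (u * y) = c ^+ m * w - d * c ^+ m.
  by rewrite /u [c ^+ m.+1]exprSr -mulrA scalerAr cyR mulrBr dC.
have k0 : q ^+ 2 * q ^+ 2 ^+ m - 1 != 0.
  by rewrite subr_eq0 -exprM -exprD; apply: qn1.
have := ID (IZ (q ^+ 2 - 1) (IMl y Iu))
  (IZ (- (q ^+ 2 * q ^+ 2 ^+ m)) (IZ (q ^+ 2 - 1) (IMr y Iu))).
rewrite e1 e2; set e3 := (X in I X -> _).
have -> : e3 = (q ^+ 2 * q ^+ 2 ^+ m - 1) *: (d * c ^+ m).
  rewrite /e3; lin_prepare K A; by ring.
by move/(IZ (q ^+ 2 * q ^+ 2 ^+ m - 1)^-1); rewrite scalerA mulVf // scale1r.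
Qed.

End IdealMonomials.

(** * Lowest terms modulo p and the extension of p to U *)

Definition ltlex (s r : int * int) := (s.2 < r.2) || (s.2 == r.2) && (s.1 < r.1).

Lemma ltlex_min (Q : int * int -> Prop) (ks : seq (int * int)) :
  (exists2 k, k \in ks & Q k) ->
  exists k0, [/\ k0 \in ks, Q k0 & forall k, k \in ks -> ltlex k k0 -> ~ Q k].
Proof.
elim: ks => [[]//|a ks IH [k]].
have [[k1 k1ks Qk1] _ _|nQ] := pselect (exists2 k, k \in ks & Q k); last first.
  rewrite inE => /orP[/eqP->|kks Qk]; last by case: nQ; exists k.
  move=> Qa; exists a; split=> //; first by rewrite inE eqxx.
  move=> k'; rewrite inE => /orP[/eqP->|k'ks _ Qk']; last by apply: nQ; exists k'.
  by rewrite /ltlex !ltxx andbF.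
have [|k0 [k0ks Qk0 min0]] := IH; first by exists k1.
have [[Qa la]|h] := pselect (Q a /\ ltlex a k0).
  exists a; split=> //; first by rewrite inE eqxx.
  move=> k'; rewrite inE => /orP[/eqP->|k'ks lk' Qk']; first by rewrite /ltlex !ltxx andbF.
  by apply: (min0 k') => //; move: lk' la; rewrite /ltlex; lia.
exists k0; split=> //; first by rewrite inE k0ks orbT.
move=> k'; rewrite inE => /orP[/eqP-> l Qa|]; first by apply: h.
exact: min0.
Qed.

Section CentralExtension.
Variables (K : fieldType) (q : K).
Hypotheses (q0 : q != 0) (qn1 : forall n, (0 < n)%N -> q ^+ n != 1).
Local Notation U := (uqB2 q).
Local Notation Z := {mpoly K[2]}.
Local Notation ev := (@eval_zz' K q).
Local Notation theta := (@theta K q).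
Local Notation qq := (q ^+ 2).

Lemma sqr_neq1 : q ^+ 2 != 1. Proof. exact: qn1. Qed.
Lemma sqr_neqN1 : q ^+ 2 != -1.
Proof.
apply: contraNneq (qn1 (n := 4) isT) => e.
by rewrite (exprM q 2 2) e sqrrN expr1n.
Qed.
Let q2 := sqr_neq1.
Let q4 := sqr_neqN1.
Let qq0 : qq != 0. Proof. by rewrite expf_neq0. Qed.

Lemma qq_inj i j : qq ^ i = qq ^ j -> i = j.
Proof.
wlog le : i j / i <= j.
  by move=> H e; case: (leP i j) => [|/ltW] h; [apply: H|apply/esym/H].
move=> e; have e1 : qq ^ (j - i) = 1.
  by rewrite expfzDr // -invr_expz e mulfV // expfz_neq0.
case: (leP j i) => h; first by apply/eqP; rewrite eq_le le h.
have [n en] : exists n : nat, j - i = n%:Z by exists `|j - i|%N; lia.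
move: e1; rewrite en -exprnP -exprM => e1.
by have := qn1 (n := 2 * n); rewrite e1 eqxx => H; have := H ltac:(lia).
Qed.

Lemma thetaD u v s : theta (u + v) s = theta u s + theta v s.
Proof. by rewrite /theta actD. Qed.

Definition extend (p : set Z) : set U := ideal_gen [set ev f | f in p].

Lemma extend_ev (p : set Z) f u : p f -> extend p (ev f * u).
Proof.
move=> pf; have [_ _ h] := ideal_gen_ideal [set ev f | f in p].
have := h 1 u (ev f); rewrite mul1r; apply.
by apply: sub_gen_smallest; exists f.
Qed.

Section Prime.
Variable p : set Z.
Hypotheses (prp : prime_set p) (p_z : ~ p 'X_0) (p_z' : ~ p 'X_1).

Lemma prime_setZ k f : p f -> p (k *: f).
Proof. by case: prp => _ _ pM _ _ pf; rewrite -mul_mpolyC; apply: pM. Qed.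

Lemma prime_setZK k f : k != 0 -> p (k *: f) -> p f.
Proof. by move=> k0 /(prime_setZ k^-1); rewrite scalerA mulVf // scale1r. Qed.

(** [s] is the lowest exponent of [theta u] modulo p. The order is total and translation invariant
    on Z^2 with x and y positive, so lowest exponents add up under products. *)
Definition low (u : U) (s : int * int) :=
  ~ p (theta u s) /\ forall r, ltlex r s -> p (theta u r).

Lemma low_mul u v s r : low u s -> low v r -> low (u * v) (s.1 + r.1, s.2 + r.2).
Proof.
have [p0 pD pM _ pP] := prp.
move=> [us lu] [vr lv]; have [ks uks hks] := theta_supported q0 q2 q4 v.
have rks : r \in ks.
  by apply: contrapT => /negP nr; apply: vr; rewrite hks.
have term s0 k : (ltlex k r \/ ltlex (s0.1 - k.1, s0.2 - k.2) s) ->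
    p (theta v k * (qq ^ ((s0.2 - k.2) * k.1) *: theta u (s0.1 - k.1, s0.2 - k.2))).
  case=> [/lv h|/lu h]; first by apply: prime_setMr.
  by apply: pM; apply: prime_setZ.
split.
  rewrite (theta_mul q0 q2 q4 _ _ _ uks hks) (bigD1_seq r) //=.
  rewrite !addrK => h; have : p (theta v r * (qq ^ (s.2 * r.1) *: theta u (s.1, s.2))).
    rewrite -[X in p X](addrK (\sum_(i <- ks | i != r)
     theta v i * (qq ^ ((s.2 + r.2 - i.2) * i.1) *: theta u (s.1 + r.1 - i.1, s.2 + r.2 - i.2)))).
    apply: prime_setB => //; apply: prime_set_sum => // k kr.
    apply: (term (s.1 + r.1, s.2 + r.2)) => /=.
    (* For k other than r, either k lies below r, or r lies below k and then s + r - k lies below s;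
       one factor of the term is in p in both cases. *)
    case: (k) (r) kr => [k1 k2] [r1 r2]; rewrite xpair_eqE /ltlex /=.
    have [h1|h1] := boolP ((k2 < r2) || (k2 == r2) && (k1 < r1)); first by left.
    by move=> h2; right; lia.
  case/pP => // /prime_setZK h'; apply: us; case: (s) h' => ? ?; apply.
  by rewrite expfz_neq0.
move=> [i j] lij; rewrite (theta_mul q0 q2 q4 _ _ _ uks hks); apply: prime_set_sum => // k _.
apply: (term (i, j)) => /=.
move: lij; case: (k) (r) (s) => [k1 k2] [r1 r2] [s1 s2]; rewrite /ltlex /= => lij.
have [h1|h1] := boolP ((k2 < r2) || (k2 == r2) && (k1 < r1)); first by left.
by right; lia.
Qed.

Lemma low1 : low 1 (0, 0).
Proof.
have [p0 _ _ p1 _] := prp.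
rewrite /low /theta act1 // /torus_delta; split; first by rewrite eqxx.
by case=> i j; rewrite /ltlex xpair_eqE /= => h; case: eqP h => [->|]; case: eqP => [->|].
Qed.

Lemma low_exp u s n : low u s -> low (u ^+ n) (s.1 * n%:Z, s.2 * n%:Z).
Proof.
move=> h; elim: n => [|n IH]; first by rewrite expr0 !mulr0; apply: low1.
rewrite exprS; have := low_mul h IH.
by rewrite /= -[n.+1]addn1 PoszD !mulrDr !mulr1 ![_ + s.1]addrC ![_ + s.2]addrC.
Qed.

Lemma low_of_val u s : ~ p (theta u s) -> (forall r, ltlex r s -> theta u r = 0) -> low u s.
Proof. by have [p0 _ _ _ _] := prp => us h; split=> // r /h->. Qed.

Let delta_eq i j : torus_delta K (0, 0) (i, j) = ((i == 0) && (j == 0))%:R.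
Proof. by rewrite /torus_delta xpair_eqE. Qed.

(** The coefficient of e1 at (0, -1) is alpha z', outside p because p avoids z'. For e2 it is the
    coefficient at (-1, 0), a nonzero multiple of z. *)
Lemma low_e1 : low (e1 q) (0, -1).
Proof.
have [p0 _ _ p1 _] := prp.
have a0 := coefA_neq0 q0 q2 q4.
apply: low_of_val; rewrite /theta act_e1 //.
  rewrite (torus_E1E q _ 0 (-1)) (addNr (1 : int)) (delta_eq 0 0) (delta_eq (0 - 2) 0).
  rewrite /= scaler0 subr0 mulr1.
  by move=> /prime_setZK h; apply: p_z'; apply: (prime_setZK a0); apply: h; rewrite expfz_neq0.
case=> i j; rewrite torus_E1E /ltlex /= !delta_eq => h.
have -> : (i == 0) && (j + 1 == 0) = false by lia.
have -> : (i - 2 == 0) && (j + 1 == 0) = false by lia.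
by rewrite mulr0 !scaler0 subr0 scaler0.
Qed.

Lemma low_e2 : low (e2 q) (-1, 0).
Proof.
have [p0 _ _ p1 _] := prp.
apply: low_of_val; rewrite /theta act_e2 //.
  rewrite (torus_E2E q _ (-1) 0) (addNr (1 : int)) (delta_eq 0 0) (delta_eq 0 (0 - 1)).
  rewrite /= scaler0 sub0r mulr1 -scaleN1r scalerA.
  move=> /prime_setZK h; apply: p_z; apply: h.
  by rewrite mulf_neq0 ?invr_eq0 ?subr_eq0 // oppr_eq0 oner_neq0.
case=> i j; rewrite torus_E2E /ltlex /= !delta_eq => h.
have -> : (i + 1 == 0) && (j - 1 == 0) = false by lia.
have -> : (i + 1 == 0) && (j == 0) = false by lia.
by rewrite mulr0 !scaler0 subr0 scaler0.
Qed.

Lemma low_e3 : low (e3 q) (1, 0).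
Proof.
have [p0 _ _ p1 _] := prp.
apply: low_of_val; rewrite /theta; first by rewrite act_e3 // delta_eq.
case=> i j; rewrite act_e3 // !delta_eq /ltlex /= => h.
by have -> : (i - 1 == 0) && (j == 0) = false by lia.
Qed.

Lemma low_w : low (comm23 q) (0, 1).
Proof.
have [p0 _ _ p1 _] := prp.
apply: low_of_val; rewrite /theta; first by rewrite act_w // delta_eq expr0z scale1r.
case=> i j; rewrite act_w // !delta_eq /ltlex /= => h.
by have -> : (i == 0) && (j - 1 == 0) = false; [lia|rewrite scaler0].
Qed.

Lemma low_basis s : low (uq_basis q s) s.
Proof.
case: s => m n; rewrite /uq_basis /basis.
suff [h1 h2] : low (basis_w (e1 q) (comm23 q) n) (0, n) /\
               low (basis_c (e2 q) (e3 q) m) (m, 0).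
  by have := low_mul h1 h2; rewrite /= add0r addr0.
split.
  case: n => n /=; first by have := low_exp n low_w; rewrite /= mul0r mul1r.
  by have := low_exp n.+1 low_e1; rewrite /= mul0r mulN1r NegzE.
case: m => m /=; first by have := low_exp m low_e3; rewrite /= mul0r mul1r.
by have := low_exp m.+1 low_e2; rewrite /= mul0r mulN1r NegzE.
Qed.

(** The basis elements have pairwise distinct lowest exponents. If some coefficient of u lies
    outside p, the least index of such a coefficient is the lowest exponent of u; otherwise u lies
    in the extension of p. *)
Lemma extend_or_low u : extend p u \/ exists s, low u s.
Proof.
have [p0 pD pM _ pP] := prp.
have [I0 ID IM] := ideal_gen_ideal [set ev f | f in p].
have [r ->] := spanned_all q0 q2 q4 u.
(* The spanning expression may repeat an index; [C k] collects its coefficients at [k]. *)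
pose ks := undup [seq t.2 | t <- r]; pose C k := \sum_(t <- r | t.2 == k) t.1.
have eu : \sum_(t <- r) ev t.1 * uq_basis q t.2 = \sum_(k <- ks) ev (C k) * uq_basis q k.
  have -> : \sum_(k <- ks) ev (C k) * uq_basis q k =
      \sum_(k <- ks) \sum_(t <- r | t.2 == k) ev t.1 * uq_basis q t.2.
    apply: eq_bigr => k _; rewrite /C (big_morph ev (@evD K q) (@ev0 K q)) mulr_suml.
    by apply: eq_bigr => t /eqP->.
  rewrite (exchange_big_dep xpredT) //= big_seq [RHS]big_seq; apply: eq_bigr => t tr.
  rewrite -big_filter (_ : [seq _ <- _ | _] = [:: t.2]) ?big_seq1 //.
  rewrite -[RHS](filter_pred1_uniq (undup_uniq [seq t.2 | t <- r])).
    by apply: eq_filter => k; exact: (eq_sym t.2 k).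
  by rewrite mem_undup map_f.
rewrite eu; have [|h] := pselect (exists2 k, k \in ks & ~ p (C k)); last first.
  left; rewrite big_seq; elim/big_ind: _ => // k kks.
  by apply: extend_ev; apply: contrapT => nk; apply: h; exists k.
move/ltlex_min => [k0 [k0ks pk0 min0]]; right; exists k0.
have thE s : theta (\sum_(k <- ks) ev (C k) * uq_basis q k) s =
    \sum_(k <- ks) C k * theta (uq_basis q k) s.
  elim: (ks) => [|k l IH]; first by rewrite !big_nil /theta act0.
  by rewrite !big_cons thetaD IH theta_ev.
(* Below k0 the coefficient [C k] is in p by minimality; from k0 on, s lies below the lowest
   exponent of the basis element. *)
have small s k : ltlex s k0 \/ (s = k0 /\ k != k0) -> k \in ks ->
    p (C k * theta (uq_basis q k) s).
  move=> h kks; have [lk|lk] := boolP (ltlex k k0).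
    by apply: prime_setMr => //; apply: contrapT => /(min0 k kks lk).
  apply: pM; have [_ lowk] := low_basis k; apply: lowk.
  case: h => [sk|[-> kk]]; first by move: sk lk; rewrite /ltlex; lia.
  by move: kk lk; case: (k) (k0) => [k1 k2] [a1 a2]; rewrite xpair_eqE /ltlex /=; lia.
split; last first.
  move=> s ls; rewrite thE big_seq; apply: prime_set_sum => // k kks.
  by apply: small => //; left.
rewrite thE (bigD1_seq k0) ?undup_uniq //= => h.
have : p (C k0 * theta (uq_basis q k0) k0).
  rewrite -[X in p X](addrK (\sum_(k <- ks | k != k0) C k * theta (uq_basis q k) k0)).
  apply: prime_setB => //; rewrite big_seq_cond; apply: prime_set_sum => // k /andP[kks kk0].
  by apply: small => //; right.
by case/pP => //; have [] := low_basis k0.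
Qed.

(** By the product formula, the elements with all coefficients in p form a two-sided ideal. *)
Lemma extend_theta u s : extend p u -> p (theta u s).
Proof.
have [p0 pD pM _ _] := prp.
move=> h; move: s; suff: extend p `<=` [set u | forall s, p (theta u s)] by apply.
apply: smallest_sub => [|_ [f pf <-] s /=]; last first.
  by rewrite -[ev f]mulr1 theta_ev //; apply: prime_setMr.
have left_mul v a : (forall s, p (theta v s)) -> forall s, p (theta (a * v) s).
  move=> pv [i j]; have [r ur hr] := theta_supported q0 q2 q4 v.
  rewrite (theta_mul q0 q2 q4 _ _ _ ur hr); apply: prime_set_sum => // k _.
  exact: prime_setMr.
have right_mul v b : (forall s, p (theta v s)) -> forall s, p (theta (v * b) s).
  move=> pv [i j]; have [r ur hr] := theta_supported q0 q2 q4 b.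
  rewrite (theta_mul q0 q2 q4 _ _ _ ur hr); apply: prime_set_sum => // k _.
  by apply: pM; apply: prime_setZ.
split=> [s|a b pa pb s|a b v pv s] /=.
- by rewrite /theta act0.
- by rewrite thetaD; apply: pD; [apply: pa|apply: pb].
by apply: right_mul; apply: left_mul.
Qed.

Lemma extend_mul u v : extend p (u * v) -> extend p u \/ extend p v.
Proof.
move=> h; have [|[s us]] := extend_or_low u; first by left.
have [|[r vr]] := extend_or_low v; first by right.
by have [n _] := low_mul us vr; case: n; apply: extend_theta.
Qed.

Lemma extend_evE f : extend p (ev f) -> p f.
Proof.
move=> /(extend_theta (0, 0)).
by rewrite -[ev f]mulr1 theta_ev // /theta act1 // delta_eq mulr1.
Qed.

Lemma extend_prime : prime_ideal (extend p).
Proof.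
have [_ _ _ p1 _] := prp.
split; first exact: ideal_gen_ideal.
  apply/eqP => /seteqP[_ /(_ 1 I)]; rewrite -(ev1 q0 q2 q4).
  by move/extend_evE.
move=> I J [_ _ IM] [_ _ JM] h.
have [sub|nsub] := pselect (I `<=` extend p); first by left.
have [u /= Iu nu] : exists2 u, I u & ~ extend p u.
  apply: contrapT => H; apply: nsub => u Iu; apply: contrapT => nu.
  by apply: H; exists u.
by right => v Jv; have [] := extend_mul (h _ _ Iu Jv).
Qed.

End Prime.

End CentralExtension.

(** * Two-sided ideals and their intersections with the centre *)

Section IdealsMeetCenter.
Variables (K : fieldType) (q : K).
Hypotheses (q0 : q != 0) (qn1 : forall n, (0 < n)%N -> q ^+ n != 1).
Local Notation U := (uqB2 q).
Local Notation Z := {mpoly K[2]}.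
Local Notation ev := (@eval_zz' K q).
Local Notation theta := (@theta K q).
Local Notation qq := (q ^+ 2).
Let q2 := sqr_neq1 qn1.
Let q4 := sqr_neqN1 qn1.
Let qq0 : qq != 0. Proof. by rewrite expf_neq0. Qed.

Lemma prime_set0 : prime_set [set (0 : Z)].
Proof.
split=> //= [a b -> ->|a b ->||a b /eqP]; rewrite ?addr0 ?mulr0 //.
  exact/eqP/oner_neq0.
by rewrite mulf_eq0 => /orP[] /eqP; [left|right].
Qed.

Lemma mpolyXi_neq0 (i : 'I_2) : ('X_i : Z) <> 0.
Proof.
move=> /(congr1 (mcoeff U_(i))) /eqP; rewrite mcoeffX eqxx mcoeff0.
by rewrite oner_eq0.
Qed.

Lemma extend0 : extend [set (0 : Z)] = [set (0 : U)].
Proof.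
apply/seteqP; split=> [|u ->]; last by have [] := ideal_gen_ideal [set ev f | f in [set (0 : Z)]].
apply: smallest_sub => [|_ [f -> <-]]; last exact: ev0.
by split=> //= [a b -> ->|a b v ->]; rewrite ?addr0 // mulr0 mul0r.
Qed.

(** The case p = 0 of [extend_or_low]: [theta] is injective. *)
Lemma theta_eq0 u : (forall s, theta u s = 0) -> u = 0.
Proof.
move=> h; have [] := extend_or_low q0 qn1 prime_set0 (@mpolyXi_neq0 0) (@mpolyXi_neq0 1) u.
  by rewrite extend0.
by case=> s [n _]; case: n; apply: h.
Qed.

Lemma thetaZ k u s : theta (k *: u) s = k *: theta u s.
Proof. by rewrite /theta actZ. Qed.

Lemma thetaB u v s : theta (u - v) s = theta u s - theta v s.
Proof. by rewrite thetaD // -scaleN1r thetaZ scaleN1r. Qed.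

Lemma theta_lmul_w u i j : theta (comm23 q * u) (i, j) = qq ^ i *: theta u (i, j - 1).
Proof. by rewrite /theta actM // act_w. Qed.

Lemma theta_lmul_e3 u i j : theta (e3 q * u) (i, j) = theta u (i - 1, j).
Proof. by rewrite /theta actM // act_e3. Qed.

Section Ideal.
Variable J : set U.
Hypothesis idJ : two_sided_ideal J.

Let JZ k u : J u -> J (k *: u).
Proof. by case: idJ => _ _ h /(h k%:A 1); rewrite mulr1 mulr_algl. Qed.
Let JB u v : J u -> J v -> J (u - v).
Proof.
by case: idJ => _ JD _ Ju Jv; apply: JD => //; rewrite -scaleN1r; apply: JZ.
Qed.
Let JMl u v : J v -> J (u * v).
Proof. by case: idJ => _ _ h /(h u 1); rewrite mulr1. Qed.
Let JMr u v : J u -> J (u * v).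
Proof. by case: idJ => _ _ h /(h 1 v); rewrite mul1r. Qed.

(** w u - q^(2 i1) u w multiplies column i by q^(2i) - q^(2 i1) while shifting it: column i1 dies
    and column i0 survives. The shift [n] counts the columns removed. Rows are treated alike with e3
    in place of w. *)
Lemma ideal_isolate_column u i0 (r : seq int) : J u -> i0 \notin r ->
  exists u' (n : int) (k : int -> K), [/\ J u', k i0 != 0, forall i, i \in r -> k i = 0
    & forall i j, theta u' (i, j) = k i *: theta u (i, j - n)].
Proof.
move=> Ju; elim: r => [|i1 r IH].
  by exists u, 0, (fun=> 1); split=> //= [|i j]; rewrite ?oner_eq0 // subr0 scale1r.
rewrite inE negb_or => /andP[i01 /IH[u' [n [k [Ju' k0 kr hk]]]]].
exists (comm23 q * u' - qq ^ i1 *: (u' * comm23 q)), (n + 1),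
  (fun i => (qq ^ i - qq ^ i1) * k i); split.
- by apply: JB; [apply: JMl|apply/JZ/JMr].
- rewrite mulf_neq0 // subr_eq0; apply: contra i01 => /eqP e.
  by rewrite (qq_inj q0 qn1 e).
- by move=> i; rewrite inE => /orP[/eqP->|/kr->]; rewrite ?subrr ?mul0r ?mulr0.
move=> i j; rewrite thetaB thetaZ theta_lmul_w theta_rmul_w // !hk opprD addrA addrAC.
by rewrite -scalerBl scalerA.
Qed.

Lemma ideal_isolate_row u j0 (r : seq int) : J u -> j0 \notin r ->
  exists u' (n : int) (k : int -> K), [/\ J u', k j0 != 0, forall j, j \in r -> k j = 0
    & forall i j, theta u' (i, j) = k j *: theta u (i - n, j)].
Proof.
move=> Ju; elim: r => [|j1 r IH].
  by exists u, 0, (fun=> 1); split=> //= [|i j]; rewrite ?oner_eq0 // subr0 scale1r.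
rewrite inE negb_or => /andP[j01 /IH[u' [n [k [Ju' k0 kr hk]]]]].
exists (u' * e3 q - qq ^ j1 *: (e3 q * u')), (n + 1),
  (fun j => (qq ^ j - qq ^ j1) * k j); split.
- by apply: JB; [apply: JMr|apply/JZ/JMl].
- rewrite mulf_neq0 // subr_eq0; apply: contra j01 => /eqP e.
  by rewrite (qq_inj q0 qn1 e).
- by move=> j; rewrite inE => /orP[/eqP->|/kr->]; rewrite ?subrr ?mul0r ?mulr0.
move=> i j; rewrite thetaB thetaZ theta_lmul_e3 theta_rmul_e3 // !hk opprD addrA addrAC.
by rewrite -scalerBl scalerA.
Qed.

Lemma ideal_isolate u s : J u -> exists u' s' k, [/\ J u', k != 0,
  theta u' s' = k *: theta u s & forall r, r != s' -> theta u' r = 0].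
Proof.
case: s => i0 j0 Ju.
have [r _ hr] := theta_supported q0 q2 q4 u.
pose r1 := [seq i <- [seq s.1 | s <- r] | i != i0].
have ni0 : i0 \notin r1 by rewrite mem_filter eqxx.
have [u1 [n1 [k1 [Ju1 k10 k1r h1]]]] := ideal_isolate_column Ju ni0.
have z1 i j : i != i0 -> theta u1 (i, j) = 0.
  move=> ii0; rewrite h1; have [ir|ir] := boolP (i \in r1); first by rewrite k1r // scale0r.
  rewrite hr ?scaler0 //; apply: contra ir => ir; rewrite mem_filter ii0.
  by apply/mapP; exists (i, j - n1).
have [r' _ hr'] := theta_supported q0 q2 q4 u1.
(* The first isolation has moved the wanted row from j0 to j0 + n1. *)
pose r2 := [seq j <- [seq s.2 | s <- r'] | j != j0 + n1].
have nj0 : j0 + n1 \notin r2 by rewrite mem_filter eqxx.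
have [u2 [n2 [k2 [Ju2 k20 k2r h2]]]] := ideal_isolate_row Ju1 nj0.
exists u2, (i0 + n2, j0 + n1), (k2 (j0 + n1) * k1 i0); split=> //.
- by rewrite mulf_neq0.
- by rewrite h2 h1 !addrK scalerA.
case=> i j; rewrite xpair_eqE negb_and => /orP[ii|jj].
  by rewrite h2 z1 ?scaler0 // subr_eq.
rewrite h2; have [jr|jr] := boolP (j \in r2); first by rewrite k2r // scale0r.
rewrite hr' ?scaler0 //; apply: contra jr => jr; rewrite mem_filter jj.
by apply/mapP; exists (i - n2, j).
Qed.

(** Multiplying by w on the right and by e3 on the left shifts exponents without introducing powers
    of q. *)
Lemma ideal_isolate_shift u s (m n : nat) : J u -> (forall r, r != s -> theta u r = 0) ->
  exists u' k, [/\ J u', k != 0, theta u' (s.1 + m%:Z, s.2 + n%:Z) = k *: theta u s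
    & forall r, r != (s.1 + m%:Z, s.2 + n%:Z) -> theta u' r = 0].
Proof.
case: s => i0 j0 Ju hu /=; elim: m => [|m [u' [k [Ju' k0 e h]]]].
  rewrite addr0; elim: n => [|n [u' [k [Ju' k0 e h]]]].
    by exists u, 1; rewrite addr0 scale1r oner_eq0.
  exists (u' * comm23 q), k; rewrite (_ : n.+1%:Z = n%:Z + 1) ?addrA; last by lia.
  split=> //; first exact: JMr.
    by rewrite theta_rmul_w // addrK.
  case=> i j ij; rewrite theta_rmul_w // h //; apply: contra ij.
  by rewrite !xpair_eqE; lia.
exists (e3 q * u'), k; rewrite (_ : m.+1%:Z = m%:Z + 1) ?addrA; last by lia.
split=> //; first exact: JMl.
  by rewrite theta_lmul_e3 // addrK.
case=> i j ij; rewrite theta_lmul_e3 // h //; apply: contra ij.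
by rewrite !xpair_eqE; lia.
Qed.

Lemma theta_monomial m n s :
  theta (e3 q ^+ m * comm23 q ^+ n) s = (s == (m%:Z, n%:Z))%:R.
Proof.
have e i j : theta (e3 q ^+ m) (i, j) = ((i, j) == (m%:Z, 0))%:R.
  elim: m i j => [|m IH] i j; first by rewrite expr0 /theta act1.
  rewrite exprS theta_lmul_e3 IH; congr (_%:R); rewrite !xpair_eqE; congr (nat_of_bool _).
  by lia.
case: s => i j; elim: n i j => [|n IH] i j; first by rewrite expr0 mulr1 e.
rewrite exprSr mulrA theta_rmul_w // IH; congr (_%:R); congr (nat_of_bool _).
by rewrite !xpair_eqE; lia.
Qed.

(* The isolated term of u is a central element times e3^m w^n, and commutators
   with e1 and e2 turn w and e3 into the central elements z' and z. *)
Lemma ideal_central_element u s : J u -> exists k m n, k != 0 /\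
  J (ev (k *: theta u s * ('X_1 ^+ n * 'X_0 ^+ m))).
Proof.
move=> Ju; have [u1 [s1 [k1 [Ju1 k10 e1 h1]]]] := ideal_isolate s Ju.
(* Shifting by absolute values makes both exponents nonnegative, so the remaining monomial lies in
   U. *)
have [u2 [k2 [Ju2 k20 e2 h2]]] := ideal_isolate_shift `|s1.1|%N `|s1.2|%N Ju1 h1.
have [m em] : exists m : nat, s1.1 + `|s1.1|%N%:Z = m%:Z.
  by exists (absz (s1.1 + `|s1.1|%N%:Z)); lia.
have [n en] : exists n : nat, s1.2 + `|s1.2|%N%:Z = n%:Z.
  by exists (absz (s1.2 + `|s1.2|%N%:Z)); lia.
rewrite em en in e2 h2.
exists (k2 * k1), m, n; split; first by rewrite mulf_neq0.
set f := (k2 * k1) *: theta u s.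
have ef : theta u2 (m%:Z, n%:Z) = f by rewrite e2 e1 scalerA.
have Jf : J (ev f * (e3 q ^+ m * comm23 q ^+ n)).
  suff <- : u2 = ev f * (e3 q ^+ m * comm23 q ^+ n) by [].
  apply/eqP; rewrite -subr_eq0; apply/eqP/theta_eq0 => r.
  rewrite thetaB theta_ev // theta_monomial.
  have [->|ne] := eqVneq r (m%:Z, n%:Z); first by rewrite ef mulr1 subrr.
  by rewrite h2 // mulr0 subr0.
(* The quotient ideal of J by the central element [ev g] is two-sided, so the monomial lemmas apply
   to it and the central factors accumulate in [g]. *)
have idI (g : Z) : two_sided_ideal [set v | J (ev g * v)].
  have [J0 JD JM] := idJ; split=> [|a b Ja Jb|a b v Jv] /=.
  - by rewrite mulr0.
  - by rewrite mulrDr; apply: JD.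
  by rewrite !mulrA -(ev_central q0 q2 q4) -!mulrA [ev g * _]mulrA; apply/JMl/JMr.
have Jw n' g : J (ev g * (e3 q ^+ m * comm23 q ^+ n')) ->
    J (ev (g * 'X_1 ^+ n') * e3 q ^+ m).
  elim: n' g => [|n' IH] g; first by rewrite !expr0 !mulr1.
  move=> /(ideal_monomial_w q0 qn1 (coefA_neq0 q0 q2 q4) (xcE q0) (wcE q0) (xwE q0 q2 q4)
    (wxE q0 q2 q4) (z'_central q0 q2 q4) (idI g)) /=.
  have -> : z' q = ev 'X_1 by rewrite evX.
  by rewrite [ev g * (ev _ * _)]mulrA -(evM q0 q2 q4) => /IH; rewrite exprS mulrA.
have Jc m' g : J (ev g * e3 q ^+ m') -> J (ev (g * 'X_0 ^+ m')).
  elim: m' g => [|m' IH] g; first by rewrite !expr0 !mulr1.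
  move=> /(ideal_monomial_c qn1 (cyE q) (ycE q) (wcE q0) (z_central q0) (idI g)) /=.
  have -> : z q = ev 'X_0 by rewrite evX.
  by rewrite [ev g * (ev _ * _)]mulrA -(evM q0 q2 q4) => /IH; rewrite exprS mulrA.
by rewrite mulrA; apply/Jc/Jw.
Qed.

(** An element of J outside the extension of p has a coefficient outside p. J then contains that
    coefficient, up to a nonzero scalar, times a monomial in z, z', which contradicts primality of
    p. *)
Lemma ideal_eq_extend (p : set Z) : prime_set p -> ~ p 'X_0 -> ~ p 'X_1 ->
  p = [set f | J (ev f)] -> J = extend p.
Proof.
move=> prp p_z p_z' ep; have [_ _ _ _ pP] := prp.
apply/seteqP; split=> [u Ju|]; last first.
  by apply: smallest_sub => // _ [f pf <-]; move: pf; rewrite ep.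
have [//|[s [us _]]] := extend_or_low q0 qn1 prp p_z p_z' u.
have [k [m [n [k0 Jf]]]] := ideal_central_element s Ju.
have : p (k *: theta u s * ('X_1 ^+ n * 'X_0 ^+ m)) by rewrite ep.
case/pP => [/(prime_setZK prp k0)//|].
by case/pP => /(prime_setX prp).
Qed.

End Ideal.

(** Primality of P is a statement about ideals; it passes to elements a, b of the centre through the
    two-sided ideals a U and b U. *)
Lemma prime_contract (P : set U) : prime_ideal P -> prime_set [set f | P (ev f)].
Proof.
case=> -[P0 PD PM] PT PP; split=> /=.
- by rewrite ev0.
- by move=> a b Pa Pb; rewrite evD; apply: PD.
- by move=> a b Pb; have := PM (ev a) 1 _ Pb; rewrite mulr1 (evM q0 q2 q4).
- rewrite (ev1 q0 q2 q4) => P1; move/eqP: PT; apply; apply/seteqP; split=> // u _.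
  by have := PM u 1 _ P1; rewrite !mulr1.
move=> a b; rewrite (evM q0 q2 q4) => Pab.
have idf f : two_sided_ideal [set v | exists u, v = ev f * u].
  split=> [|v v' [u ->] [u' ->]|c d v [u ->]] /=.
  - by exists 0; rewrite mulr0.
  - by exists (u + u'); rewrite mulrDr.
  by exists (c * u * d); rewrite !mulrA (ev_central q0 q2 q4).
have self f : exists u, ev f = ev f * u by exists 1; rewrite mulr1.
case: (PP _ _ (idf a) (idf b)) => [_ _ [u ->] [v ->]|sub|sub].
- have := PM u v _ Pab; congr (P _).
  by rewrite !mulrA (ev_central q0 q2 q4 _ u).
- by left; apply: sub; apply: self.
by right; apply: sub; apply: self.
Qed.

End IdealsMeetCenter.

(** * Torus weights and the stratum of the zero ideal *)

Section TorusStratum.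
Variables (K : fieldType) (q : K).
Hypotheses (q0 : q != 0) (qn1 : forall n, (0 < n)%N -> q ^+ n != 1).
Local Notation U := (uqB2 q).
Local Notation Z := {mpoly K[2]}.
Local Notation ev := (@eval_zz' K q).
Let q2 := sqr_neq1 qn1.
Let q4 := sqr_neqN1 qn1.

Implicit Types (h : K * K) (P : set U).

Lemma torus_actM h (k : K * K) u : torus_act h (torus_act k u) =
  torus_act (h.1 * k.1, h.2 * k.2) u :> U.
Proof.
elim/uqB2_ind: u => [||c u v hu hv|u hu|u hu].
- by rewrite !rmorph0.
- by rewrite !rmorph1.
- by rewrite !linearP /= hu hv.
- by rewrite !rmorphM /= hu !torus_act_e1 linearZ /= torus_act_e1 scalerA mulrC.
by rewrite !rmorphM /= hu !torus_act_e2 linearZ /= torus_act_e2 scalerA mulrC.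
Qed.

Lemma torus_act_id (u : U) : torus_act (1, 1) u = u.
Proof.
elim/uqB2_ind: u => [||c u v hu hv|u hu|u hu].
- by rewrite rmorph0.
- by rewrite rmorph1.
- by rewrite linearP /= hu hv.
- by rewrite rmorphM /= hu torus_act_e1 scale1r.
by rewrite rmorphM /= hu torus_act_e2 scale1r.
Qed.

Definition torus_inv h : K * K := (h.1^-1, h.2^-1).

Lemma torus_actK h (u : U) : torus h -> torus_act h (torus_act (torus_inv h) u) = u.
Proof. by case=> h1 h2; rewrite torus_actM /= !mulfV // torus_act_id. Qed.

Lemma torus_act_e3 h : torus_act h (e3 q) = (h.1 * h.2) *: e3 q.
Proof.
rewrite /e3 rmorphB /= [torus_act h (_ *: _)]linearZ !rmorphM /= torus_act_e1 torus_act_e2.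
rewrite -!(scalerAl, scalerAr) !scalerA scalerBr scalerA.
by congr (_ *: _ - _ *: _); ring.
Qed.

Lemma torus_act_e3bar h : torus_act h (e3bar q) = (h.1 * h.2) *: e3bar q.
Proof.
rewrite /e3bar rmorphB /= [torus_act h (_ *: _)]linearZ !rmorphM /= torus_act_e1 torus_act_e2.
rewrite -!(scalerAl, scalerAr) !scalerA scalerBr scalerA.
by congr (_ *: _ - _ *: _); ring.
Qed.

Lemma torus_act_z h : torus_act h (z q) = (h.1 * h.2 ^+ 2) *: z q.
Proof.
rewrite /z rmorphB /= [torus_act h (_ *: _)]linearZ !rmorphM /= torus_act_e3 torus_act_e2.
rewrite -!(scalerAl, scalerAr) !scalerA scalerBr scalerA.
by congr (_ *: _ - _ *: _); ring.
Qed.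

Lemma torus_act_z' h : torus_act h (z' q) = (h.1 * h.2) ^+ 2 *: z' q.
Proof.
rewrite /z' [torus_act h (_ *: _)]linearZ rmorphD /= [torus_act h (_ *: _)]linearZ !rmorphM /= torus_act_e3 torus_act_e3bar.
rewrite torus_act_z torus_act_e1 -!(scalerAl, scalerAr) !scalerA.
rewrite !scalerDr !scalerA.
by congr (_ *: _ + _ *: _); ring.
Qed.

(** The weight of the central monomial with exponent [m]: z has weight h1 h2^2 and z' has weight (h1
    h2)^2. *)
Definition torus_char h (m : 'X_{1..2}) : K :=
  (h.1 * h.2 ^+ 2) ^+ m 0 * (h.1 * h.2) ^+ 2 ^+ m 1.

Lemma evXm (m : 'X_{1..2}) : ev 'X_[m] = z q ^+ m 0 * z' q ^+ m 1.
Proof.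
rewrite /eval_zz' mmapX /mmap1 big_ord_recl big_ord_recl big_ord0 mulr1 /=.
by congr (_ * _ ^+ m _); apply: val_inj.
Qed.

Lemma torus_act_evXm h m : torus_act h (ev 'X_[m]) = torus_char h m *: ev 'X_[m].
Proof.
rewrite evXm rmorphM !rmorphXn /= torus_act_z torus_act_z' !exprZn.
by rewrite -scalerAl -scalerAr scalerA.
Qed.

Lemma torus_separates m n : m != n -> exists2 h, torus h & torus_char h m != torus_char h n.
Proof.
have expr_inj (t : K) i j : (forall n, (0 < n)%N -> t ^+ n != 1) -> t != 0 ->
    t ^+ i = t ^+ j -> i = j.
  move=> tn1 t0; wlog le : i j / (i <= j)%N.
    by move=> H e; case/orP: (leq_total i j) => l; [apply: H|apply/esym/H].
  move=> e; apply/eqP; rewrite eqn_leq le -subn_eq0 -leqn0 leqNgt; apply/negP => /tn1.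
  by rewrite -(inj_eq (mulfI (expf_neq0 i t0))) -exprD subnKC // mulr1 e eqxx.
have [e0|n0] := eqVneq (m 0) (n 0) => mn.
  have n1 : m 1 != n 1.
    apply: contra mn => /eqP e1; apply/eqP/mnmP => i.
    by have [->|->] := ord2P i.
  (* This torus element fixes z and scales z' by q^2. *)
  exists (q ^+ 2, q^-1); first by split; rewrite /= ?expf_neq0 ?invr_eq0.
  rewrite /torus_char /= e0 exprVn mulfV ?expf_neq0 // expr1n !mul1r.
  have -> : q ^+ 2 / q = q by rewrite expr2 mulfK.
  apply: contra n1 => /eqP /expr_inj -> //; rewrite ?expf_neq0 // => k k0.
  by rewrite -exprM qn1 // muln_gt0.
(* This one scales z by q and fixes z'. *)
exists (q^-1, q); first by split; rewrite /= ?invr_eq0.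
rewrite /torus_char /= mulVf // !expr1n !mulr1 expr2 mulKf //.
by apply: contra n0 => /eqP /expr_inj ->.
Qed.

(** Applying h and subtracting the weight of m removes the term m from a sum; if h separates m from
    m', the term m' survives. Induction on the number of terms ends with a single monomial. *)
Lemma stable_ideal_monomial (J : set U) f : two_sided_ideal J ->
  (forall h u, torus h -> J u -> J (torus_act h u)) ->
  J (ev f) -> f != 0 -> exists m : 'X_{1..2}, J (ev 'X_[m]).
Proof.
move=> [J0 JD JM] Jh Jf f0.
have JZ k u : J u -> J (k *: u) by move/(JM k%:A 1); rewrite mulr1 mulr_algl.
have evsum (r : seq 'X_{1..2}) (c : 'X_{1..2} -> K) :
    ev (\sum_(m <- r) c m *: 'X_[m]) = \sum_(m <- r) c m *: ev 'X_[m].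
  rewrite (big_morph ev (@evD K q) (@ev0 K q)); apply: eq_bigr => m _.
  by rewrite evZ.
suff ind n (r : seq 'X_{1..2}) (c : 'X_{1..2} -> K) : (size r <= n)%N -> r != [::] ->
    uniq r -> (forall m, m \in r -> c m != 0) ->
    J (\sum_(m <- r) c m *: ev 'X_[m]) -> exists m, J (ev 'X_[m]).
  apply: (ind _ (msupp f) (fun m => f@_m) (leqnn _)); rewrite ?msupp_eq0 ?msupp_uniq //.
    by move=> m; rewrite mcoeff_msupp.
  by rewrite -evsum -mpolyE.
elim: n r c => [|n IH] [|m r] c //= sr _ /andP[mr ur] cr Jr.
case: r => [|m' r] in sr mr ur cr Jr *.
  exists m; move: Jr; rewrite big_seq1 => /(JZ (c m)^-1).
  by rewrite scalerA mulVf ?scale1r // cr // mem_head.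
have mm' : m' != m by move: mr; rewrite inE negb_or eq_sym => /andP[].
have [h th ch] := torus_separates mm'.
pose c' k := c k * (torus_char h k - torus_char h m).
pose r' := [seq k <- m :: m' :: r | torus_char h k != torus_char h m].
apply: (IH r' c').
- rewrite -ltnS; apply: leq_trans sr.
  rewrite /r' [filter _ (m :: _)]/= eqxx /= ltnS.
  exact: leq_trans (size_subseq (filter_subseq _ (m' :: r))) _.
- have : m' \in r' by rewrite mem_filter ch !inE eqxx orbT.
  by case: (r').
- by apply: filter_uniq; rewrite [uniq _]/= mr.
- move=> k; rewrite mem_filter => /andP[ck kr].
  by rewrite mulf_neq0 ?subr_eq0 ?cr.
have := JD _ _ (Jh h _ th Jr) (JZ (- torus_char h m) _ Jr).
set S := (X in J X -> _); set T := (X in _ -> J X).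
suff -> : S = T by [].
rewrite /S /T rmorph_sum scaler_sumr -big_split /r' big_filter [RHS]big_mkcond /=.
apply: eq_bigr => k _; rewrite linearZ /= torus_act_evXm !scalerA -scalerDl /c'.
have -> : c k * torus_char h k + - torus_char h m * c k =
   c k * (torus_char h k - torus_char h m) by ring.
by case: eqP => [->|] //; rewrite subrr mulr0 scale0r.
Qed.

Definition torus_core P : set U := \bigcap_(h in @torus K) (torus_act h @` P).

Lemma torus_core_ideal P : two_sided_ideal P -> two_sided_ideal (torus_core P).
Proof.
move=> [P0 PD PM]; split=> [h th|u v Pu Pv h th|a b u Pu h th].
- by exists 0; rewrite ?rmorph0.
- have [u' Pu' <-] := Pu h th; have [v' Pv' <-] := Pv h th.
  by exists (u' + v'); rewrite ?rmorphD //; apply: PD.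
have [u' Pu' <-] := Pu h th.
exists (torus_act (torus_inv h) a * u' * torus_act (torus_inv h) b); first exact: PM.
by rewrite !rmorphM /= !torus_actK.
Qed.

Lemma torus_core_stable P h u : torus h -> torus_core P u -> torus_core P (torus_act h u).
Proof.
(* The translate of P by k is reached from its translate by h^-1 k. *)
move=> th Pu k tk; have [|v Pv <-] := Pu (h.1^-1 * k.1, h.2^-1 * k.2).
  by case: th tk => ? ? [? ?]; split; rewrite /= mulf_neq0 ?invr_eq0.
exists v => //; rewrite torus_actM /=.
by case: th => h1 h2; rewrite !mulVKf // -surjective_pairing.
Qed.

Lemma torus_core_sub P : torus_core P `<=` P.
Proof.
move=> u /(_ (1, 1)) [|v Pv <-]; first by split; apply: oner_neq0.
by rewrite torus_act_id.
Qed.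

Lemma prime_set_mnm (p : set Z) m : prime_set p -> p 'X_[m] -> p 'X_0 \/ p 'X_1.
Proof.
move=> prp; have [_ _ _ p1 pP] := prp.
rewrite mpolyXE_id big_ord_recl big_ord_recl big_ord0 mulr1 => /pP[] /(prime_setX prp) h.
  by left.
by right; move: h; congr (p 'X_ _); apply: val_inj.
Qed.

Lemma stratum_extend (p : set Z) : prime_set p -> ~ p 'X_0 -> ~ p 'X_1 ->
  stratum [set 0] (extend (q := q) p).
Proof.
move=> prp p_z p_z'; have pr := extend_prime q0 qn1 prp p_z p_z'.
split=> //; rewrite -/(torus_core _); have [ide _ _] := pr.
have idc := torus_core_ideal ide.
apply/seteqP; split=> [u cu|u ->]; last by have [] := idc.
apply: contrapT => u0; apply: u0; apply: (theta_eq0 q0 qn1) => s.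
apply: contrapT => /eqP us.
have [k [m [n [k0 cf]]]] := ideal_central_element q0 qn1 idc s cu.
have f0 : k *: theta u s * ('X_1 ^+ n * 'X_0 ^+ m) != 0.
  rewrite !mulf_neq0 ?scaler_eq0 ?negb_or ?k0 ?us ?expf_neq0 //; apply/eqP/mpolyXi_neq0.
have [mm cm] := stable_ideal_monomial idc (@torus_core_stable _) cf f0.
by have [] := prime_set_mnm prp (extend_evE q0 qn1 prp (torus_core_sub cm)).
Qed.

(** z and z' are torus eigenvectors with nonzero weights, so if P contained one of them every
    translate of P would, and the core would not be zero. *)
Lemma stratum_avoids P : stratum [set (0 : U)] P -> ~ P (z q) /\ ~ P (z' q).
Proof.
case=> -[[P0 PD PM] _ _]; rewrite -/(torus_core P) => core0.
have eigen u (c : K * K -> K) : P u -> (forall h, torus h -> c h != 0) ->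
    (forall h, torus_act h u = c h *: u) -> u = 0.
  move=> Pu c0 hu; have : torus_core P u; last by rewrite core0.
  move=> h th; exists ((c h)^-1 *: u); first by have := PM (c h)^-1%:A 1 u Pu; rewrite mulr1 mulr_algl.
  by rewrite linearZ /= hu scalerA mulVf ?scale1r // c0.
have nz i : ev 'X_i <> 0 :> U.
  move=> e; apply: (@mpolyXi_neq0 K i); apply: (extend_evE q0 qn1 (@prime_set0 K)).
  by rewrite extend0 // e.
split=> [Pz|Pz].
  apply: (nz 0); rewrite evX /=; apply: (eigen _ _ Pz _ torus_act_z) => h [h1 h2].
  by rewrite mulf_neq0 ?expf_neq0.
apply: (nz 1); rewrite evX /=; apply: (eigen _ _ Pz _ torus_act_z') => h [h1 h2].
by rewrite expf_neq0 ?mulf_neq0.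
Qed.

Lemma avoiding_prime_extend P : prime_ideal P -> ~ P (z q) -> ~ P (z' q) ->
  exists p : set Z, [/\ prime_set p, ~ p 'X_0, ~ p 'X_1 & P = extend (q := q) p].
Proof.
move=> pr Pz Pz'; have [ide _ _] := pr.
have prp := prime_contract q0 qn1 pr.
exists [set f | P (ev f)]; rewrite /= !evX; split=> //.
by apply: (ideal_eq_extend q0 qn1) => //=; rewrite evX.
Qed.

End TorusStratum.

(** * Transport of the classification to C[z, z'], and inclusions of primes *)

Section MpolyPrimes.
Variable K : closedFieldType.
Local Notation Z := {mpoly K[2]}.
Local Notation S := {poly {poly K}}.

Definition polyCC : {rmorphism K -> S} := polyC \o polyC.

Definition to_poly2 (f : Z) : S := mmap polyCC (fun i => if i == 0 then 'X%:P else 'X) f.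

Fact to_poly2_zmod : zmod_morphism to_poly2.
Proof. exact: mmap_is_additive. Qed.

Fact to_poly2_monoid : monoid_morphism to_poly2.
Proof. by have [hM h1] : multiplicative to_poly2 by exact: mmap_is_multiplicative. Qed.

HB.instance Definition _ := GRing.isZmodMorphism.Build Z S to_poly2 to_poly2_zmod.
HB.instance Definition _ := GRing.isMonoidMorphism.Build Z S to_poly2 to_poly2_monoid.

Definition of_poly1 : {poly K} -> Z :=
  horner_morph (fun c => mulrC ('X_0 : Z) ((@mpolyC 2 K) c)).
HB.instance Definition _ := GRing.RMorphism.copy of_poly1
  (horner_morph (fun c => mulrC ('X_0 : Z) ((@mpolyC 2 K) c))).

Definition of_poly2 : S -> Z := horner_morph (fun c => mulrC ('X_1 : Z) (of_poly1 c)).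
HB.instance Definition _ := GRing.RMorphism.copy of_poly2
  (horner_morph (fun c => mulrC ('X_1 : Z) (of_poly1 c))).

Lemma to_poly2C c : to_poly2 c%:MP = c%:P%:P.
Proof. by rewrite /to_poly2 mmapC. Qed.

Lemma to_poly2X i : to_poly2 'X_i = if i == 0 then 'X%:P else 'X.
Proof. by rewrite /to_poly2 mmapX mmap1U. Qed.

Lemma of_poly1C c : of_poly1 c%:P = c%:MP.
Proof. exact: horner_morphC. Qed.

Lemma of_poly1X : of_poly1 'X = 'X_0.
Proof. exact: horner_morphX. Qed.

Lemma of_poly2C c : of_poly2 c%:P = of_poly1 c.
Proof. exact: horner_morphC. Qed.

Lemma of_poly2X : of_poly2 'X = 'X_1.
Proof. exact: horner_morphX. Qed.

Lemma to_poly2K : cancel to_poly2 of_poly2.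
Proof.
elim/mpoly2_ind => [||c f g hf hg|i f hf].
- by rewrite !rmorph0.
- by rewrite !rmorph1.
- by rewrite -mul_mpolyC !rmorphD !rmorphM /= hf hg to_poly2C of_poly2C of_poly1C.
rewrite !rmorphM /= hf to_poly2X; congr (_ * _).
have [->|->] := ord2P i.
  by rewrite /= of_poly2C of_poly1X.
by rewrite /= of_poly2X.
Qed.

Lemma of_poly2K : cancel of_poly2 to_poly2.
Proof.
have h1 c : to_poly2 (of_poly1 c) = c%:P.
  elim/poly_ind: c => [|c a IH]; first by rewrite !rmorph0.
  by rewrite !rmorphD !rmorphM /= IH of_poly1C of_poly1X to_poly2C to_poly2X.
elim/poly_ind => [|p c IH]; first by rewrite !rmorph0.
by rewrite !rmorphD !rmorphM /= IH of_poly2C of_poly2X h1 to_poly2X.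
Qed.

Lemma prime_set_preim (A B : comNzRingType) (phi : {rmorphism A -> B}) (p : set B) :
  prime_set p -> prime_set [set a | p (phi a)].
Proof.
case=> p0 pD pM p1 pP; split=> /= [|a b|a b||a b].
- by rewrite rmorph0.
- by rewrite rmorphD; apply: pD.
- by rewrite rmorphM; apply: pM.
- by rewrite rmorph1.
by rewrite rmorphM; apply: pP.
Qed.

Lemma irreducible_elt_iso (A B : idomainType) (phi : {rmorphism A -> B})
    (psi : {rmorphism B -> A}) f :
  cancel phi psi -> cancel psi phi -> irreducible_elt f -> irreducible_elt (phi f).
Proof.
move=> phiK psiK [f0 fu irr].
have unitE a : (phi a \is a GRing.unit) = (a \is a GRing.unit).
  by apply/idP/idP => [/(rmorph_unit psi)|/(rmorph_unit phi)//]; rewrite phiK.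
split.
- by rewrite -(rmorph0 phi) (can_eq phiK).
- by rewrite unitE.
move=> a b e; have /irr : f = psi a * psi b by rewrite -rmorphM -e phiK.
by rewrite -!unitE !psiK.
Qed.

Lemma mpoly2_irreducible_prime (P : Z) : irreducible_elt P -> prime_set (principal P).
Proof.
move=> irr; have irr2 := irreducible_elt_iso to_poly2K of_poly2K irr.
have := prime_set_preim to_poly2 (bivariate_irreducible_prime irr2).
congr prime_set; apply/seteqP; split=> f [g e].
  by exists (of_poly2 g); rewrite -[f]to_poly2K e rmorphM /= to_poly2K.
by exists (to_poly2 g); rewrite e rmorphM.
Qed.

Definition point_ideal (x y : K) : set Z := generated2 ('X_0 - x%:MP) ('X_1 - y%:MP).

Lemma mpoly2_prime_classification (p : set Z) : prime_set p ->
  [\/ p = [set 0], exists2 P, irreducible_elt P & p = principal P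
    | exists x y, p = point_ideal x y].
Proof.
move=> prp; have pE f : p f = [set g | p (of_poly2 g)] (to_poly2 f).
  by rewrite /= to_poly2K.
case: (bivariate_prime_classification (prime_set_preim of_poly2 prp)) => [e|[P irr e]|[x [y e]]].
- constructor 1; apply/funext => f; rewrite pE e /=; apply/propext; split=> [h|->].
    by rewrite -[f]to_poly2K h rmorph0.
  by rewrite rmorph0.
- constructor 2; exists (of_poly2 P); first exact: irreducible_elt_iso of_poly2K to_poly2K irr.
  apply/funext => f; rewrite pE e; apply/propext; split=> -[g eg].
    by exists (of_poly2 g); rewrite -[f]to_poly2K eg rmorphM.
  by exists (to_poly2 g); rewrite eg rmorphM /= of_poly2K.
constructor 3; exists x, y; apply/funext => f; rewrite pE e.
have eX : of_poly2 ('X - x%:P)%:P = 'X_0 - x%:MP.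
  by rewrite of_poly2C rmorphB /= of_poly1X of_poly1C.
have eY : of_poly2 ('X - y%:P%:P) = 'X_1 - y%:MP.
  by rewrite rmorphB /= of_poly2X of_poly2C of_poly1C.
apply/propext; split=> -[g [h eg]].
  exists (of_poly2 g), (of_poly2 h).
  by rewrite -[f]to_poly2K eg rmorphD !rmorphM /= eX eY.
exists (to_poly2 g), (to_poly2 h).
by rewrite eg -eX -eY rmorphD !rmorphM /= !of_poly2K.
Qed.

Definition point (x y : K) : 'I_2 -> K := fun i => if i == 0 then x else y.

(** Modulo the two generators every polynomial is congruent to a constant, which is its value at the
    point. *)
Lemma point_idealE x y f : point_ideal x y f <-> f.@[point x y] = 0.
Proof.
split=> [[g [h ->]]|].
  rewrite mevalD !mevalM !mevalB !mevalXU !mevalC /point /=.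
  by rewrite !subrr !mulr0 addr0.
have [a [g [h eg]]] : exists a g h,
    f = a%:MP + g * ('X_0 - x%:MP) + h * ('X_1 - y%:MP).
  elim/mpoly2_ind: f => [||c f f' [a [g [h ->]]] [a' [g' [h' ->]]]|i f [a [g [h ->]]]].
  - by exists 0, 0, 0; rewrite mpolyC0; ring.
  - by exists 1, 0, 0; rewrite mpolyC1; ring.
  - exists (c * a + a'), (c *: g + g'), (c *: h + h').
    by rewrite mpolyCD mpolyCM -!mul_mpolyC; ring.
  have [->|->] := ord2P i.
    exists (x * a), ('X_0 * g + a%:MP), ('X_0 * h).
    by rewrite mpolyCM; ring.
  exists (y * a), ('X_1 * g), ('X_1 * h + a%:MP).
  by rewrite mpolyCM; ring.
rewrite {1}eg !mevalD !mevalM !mevalB !mevalXU !mevalC /point /= !subrr !mulr0 !addr0 => a0.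
by exists g, h; rewrite eg a0 mpolyC0 add0r.
Qed.

Lemma point_ideal_prime x y : prime_set (point_ideal x y).
Proof.
split=> [|a b|a b||a b]; rewrite !point_idealE.
- exact: meval0.
- by rewrite mevalD => -> ->; rewrite addr0.
- by rewrite mevalM => ->; rewrite mulr0.
- by rewrite meval1; apply/eqP/oner_neq0.
by rewrite mevalM => /eqP; rewrite mulf_eq0 => /orP[]/eqP; [left|right].
Qed.

Lemma point_ideal_maximal x y (p : set Z) : prime_set p -> point_ideal x y `<=` p ->
  p `<=` point_ideal x y.
Proof.
move=> prp sub f pf; apply/point_idealE; apply: contrapT => /eqP a0.
have [_ _ pM p1 _] := prp; apply: p1.
set a := f.@[_] in a0.
have pa : p a%:MP.
  have -> : a%:MP = f - (f - a%:MP) by ring.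
  apply: prime_setB => //; apply: sub; apply/point_idealE.
  by rewrite mevalB mevalC subrr.
have <- : (a^-1)%:MP * a%:MP = 1 :> Z by rewrite -mpolyCM mulVf.
exact: pM.
Qed.

Lemma msize1_unit (f : Z) : msize f = 1%N -> f \is a GRing.unit.
Proof.
move/eqP/msize_poly1P => [c c0 ->]; apply/unitrP; exists (c^-1)%:MP.
by rewrite -!mpolyCM mulVf ?mulfV ?mpolyC1.
Qed.

Lemma unit_msize1 (f : Z) : f \is a GRing.unit -> msize f = 1%N.
Proof.
move=> uf; have e := mulrV uf.
have f0 : f != 0 by apply: contraTneq uf => ->; rewrite unitr0.
have g0 : f^-1 != 0 by rewrite invr_eq0.
have := msizeM f0 g0; rewrite e msize1.
have : msize f != 0%N by rewrite msize_poly_eq0.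
have : msize f^-1 != 0%N by rewrite msize_poly_eq0.
by move: (msize f) (msize _) => m n; lia.
Qed.

(** [msize] is the total degree plus one; degrees add, so a factor of a polynomial of degree one has
    degree zero or its cofactor has. *)
Lemma msize2_irreducible (f : Z) : msize f = 2%N -> irreducible_elt f.
Proof.
move=> sf; have f0 : f != 0 by rewrite -msize_poly_eq0 sf.
split=> //; first by apply/negP => /unit_msize1; rewrite sf.
move=> a b e; have [a0 b0] : a != 0 /\ b != 0.
  by move: f0; rewrite e mulf_eq0 negb_or => /andP.
have := msizeM a0 b0; rewrite -e sf => h.
have : msize a = 1%N \/ msize b = 1%N.
  have : msize a != 0%N by rewrite msize_poly_eq0.
  have : msize b != 0%N by rewrite msize_poly_eq0.
  by move: (msize a) (msize b) h => m n; lia.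
by case=> /msize1_unit; [left|right].
Qed.

Lemma mpolyXi_subC_irreducible (i : 'I_2) x : irreducible_elt ('X_i - x%:MP : Z).
Proof.
apply: msize2_irreducible.
have l0 : (mlead (- x%:MP : Z) < mlead ('X_i : Z))%O.
  rewrite mleadN mleadC mleadXm lt_neqAle le0m andbT eq_sym; apply/eqP => /(congr1 (fun m : 'X_{1..2} => m i)).
  by rewrite mnm1E eqxx mnm0E.
have e := mleadDl l0.
rewrite -mlead_deg ?e ?mleadXm ?mdeg1 //.
by apply: contraTneq l0 => h; rewrite -e h mlead0 mleadN mleadC ltxx.
Qed.

Lemma mpolyXi_irreducible (i : 'I_2) : irreducible_elt ('X_i : Z).
Proof. by apply: msize2_irreducible; rewrite msizeX mdeg1. Qed.

Lemma irreducible_associate (f g : Z) : irreducible_elt f -> irreducible_elt g ->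
  principal g f -> exists2 u, u \is a GRing.unit & f = u * g.
Proof.
move=> [_ _ irr] [_ gu _] [u e]; exists u => //.
by case: (irr _ _ e) => //; rewrite (negPf gu).
Qed.

Lemma principal_unit (u g : Z) : u \is a GRing.unit -> principal (u * g) = principal g.
Proof.
move=> uu; apply/seteqP; split=> f [h ->]; first by exists (h * u); rewrite mulrA.
by exists (h * u^-1); rewrite mulrA mulrVK.
Qed.

(** P would be an associate of X_0 - x and would also divide X_1 - y; evaluation at (x, y + 1)
    excludes this. *)
Lemma principal_neq_point (P : Z) x y : irreducible_elt P -> principal P <> point_ideal x y.
Proof.
move=> irr e.
have [u uu eu] : exists2 u, u \is a GRing.unit & 'X_0 - x%:MP = u * P.
  apply: irreducible_associate => //; first exact: mpolyXi_subC_irreducible.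
  by rewrite e; apply/point_idealE; rewrite mevalB mevalXU mevalC subrr.
have : principal P ('X_1 - y%:MP).
  by rewrite e; apply/point_idealE; rewrite mevalB mevalXU mevalC subrr.
rewrite -(principal_unit P uu) -eu => -[g /(congr1 (meval (point x (y + 1))))].
rewrite mevalM !mevalB !mevalXU !mevalC /point /= subrr mulr0 addrC addKr.
by move/eqP; rewrite oner_eq0.
Qed.

(** The dimension bound behind both heights: point ideals are maximal, and an irreducible polynomial
    dividing another one is its associate, so above a nonzero prime there is room only for a point
    ideal. *)
Lemma prime_above_nonzero (p p' : set Z) : prime_set p -> prime_set p' ->
  p `<` p' -> p <> [set 0] -> exists x y, p' = point_ideal x y.
Proof.
move=> prp prp' [sub np] pn0.
case: (mpoly2_prime_classification prp) => [//|[P irr e]|[x [y e]]]; last first.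
  by case: np; rewrite e; apply: point_ideal_maximal; rewrite -?e.
case: (mpoly2_prime_classification prp') => [e'|[Q irrQ e']|//].
  by have [+ _ _] := irr; case/eqP; have : p' P by [apply: sub; rewrite e; apply: principal_id]; rewrite e'.
have [|u uu eu] := irreducible_associate irr irrQ.
  by rewrite -e'; apply: sub; rewrite e; apply: principal_id.
by case: np; rewrite e e' eu principal_unit.
Qed.

Lemma mleadc1_irreducible (P : Z) : irreducible_elt P ->
  exists2 Q : Z, irreducible_elt Q /\ mleadc Q = 1 & principal Q = principal P.
Proof.
move=> irr; have [P0 Pu irrP] := irr; have c0 : mleadc P != 0 by rewrite mleadc_eq0.
have uc : ((mleadc P)^-1%:MP : Z) \is a GRing.unit.
  by apply: msize1_unit; rewrite msizeC invr_eq0 c0.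
exists ((mleadc P)^-1 *: P); last by rewrite -mul_mpolyC principal_unit.
split; last by rewrite mleadcZE mulVf.
rewrite -mul_mpolyC; split.
- by rewrite mulf_neq0 //; apply: contraTneq uc => ->; rewrite unitr0.
- by rewrite unitrMr.
move=> a b e; have : P = ((mleadc P)%:MP * a) * b.
  by rewrite -mulrA -e mulrA -mpolyCM mulfV // mpolyC1 mul1r.
have um : ((mleadc P)%:MP : Z) \is a GRing.unit.
  by apply: msize1_unit; rewrite msizeC c0.
by case/irrP; rewrite ?unitrMr //; [left|right].
Qed.

Lemma monic_irreducible_principalX (P : Z) i : irreducible_elt P -> mleadc P = 1 ->
  principal P 'X_i -> P = 'X_i.
Proof.
move=> irr lP /(irreducible_associate (mpolyXi_irreducible i) irr)[u uu e].
have /eqP/msize_poly1P[c _ eu] := unit_msize1 uu.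
have := congr1 (fun f => mleadc f) e; rewrite eu mul_mpolyC mleadcZE lP mulr1 mleadXm mcoeffX eqxx => c1.
by rewrite e eu -c1 mpolyC1 mul1r.
Qed.

End MpolyPrimes.

(** * Chains of primes, heights and the final classification *)

Section Heights.
Variables (K : closedFieldType) (q : K).
Hypotheses (q0 : q != 0) (qn1 : forall n, (0 < n)%N -> q ^+ n != 1).
Local Notation U := (uqB2 q).
Local Notation Z := {mpoly K[2]}.
Local Notation ev := (@eval_zz' K q).
Local Notation extend := (@extend K q).
Let q2 := sqr_neq1 qn1.
Let q4 := sqr_neqN1 qn1.

Lemma ideal_gen_principal (P : Z) : ideal_gen [set ev P] = extend (principal P).
Proof.
apply/seteqP; split; apply: smallest_sub; try exact: ideal_gen_ideal.
  by move=> _ ->; rewrite -[ev P]mulr1; apply: extend_ev; exact: principal_id.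
move=> _ [_ [f ->] <-]; have [_ _ h] := ideal_gen_ideal [set ev P].
have := h (ev f) 1 (ev P); rewrite mulr1 -(evM q0 q2 q4); apply.
exact: sub_gen_smallest.
Qed.

Lemma ideal_gen_point (a b : K) :
  ideal_gen [set z q - a%:A; z' q - b%:A] = extend (point_ideal a b).
Proof.
have ez : z q - a%:A = ev ('X_0 - a%:MP) by rewrite evB evX evC.
have ez' : z' q - b%:A = ev ('X_1 - b%:MP) by rewrite evB evX evC.
rewrite ez ez'; apply/seteqP; split; apply: smallest_sub; try exact: ideal_gen_ideal.
  by move=> _ [] ->; rewrite -[ev _]mulr1; apply: extend_ev; apply/point_idealE;
    rewrite mevalB mevalXU mevalC subrr.
move=> _ [_ [f [g ->]] <-].
set G := [set _; _]; have [_ hD hM] := ideal_gen_ideal G.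
have sub := @sub_gen_smallest U (@two_sided_ideal U) G.
rewrite evD !(evM q0 q2 q4); apply: hD.
  by have := hM (ev f) 1 _ (sub _ (or_introl erefl)); rewrite mulr1.
by have := hM (ev g) 1 _ (sub _ (or_intror erefl)); rewrite mulr1.
Qed.

Lemma ideal_gen0 : ideal_gen [set (0 : U)] = extend [set 0].
Proof.
rewrite extend0; apply/seteqP; split=> [|_ ->]; last by have [] := ideal_gen_ideal [set (0 : U)].
apply: smallest_sub => // ; split=> //= [a b -> ->|a b v ->]; rewrite ?addr0 //.
by rewrite mulr0 mul0r.
Qed.

Lemma extend_subset (p p' : set Z) : p `<=` p' -> extend p `<=` extend p'.
Proof.
move=> sub; apply: smallest_sub; first exact: ideal_gen_ideal.
by move=> _ [f pf <-]; rewrite -[ev f]mulr1; apply: extend_ev; exact: sub.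
Qed.

Lemma extend_subsetK (p p' : set Z) : prime_set p' -> extend p `<=` extend p' -> p `<=` p'.
Proof.
move=> prp' sub f pf; apply: (extend_evE q0 qn1 prp'); apply: sub.
by rewrite -[ev f]mulr1; apply: extend_ev.
Qed.

Lemma extend_inj (p p' : set Z) : prime_set p -> prime_set p' ->
  extend p = extend p' -> p = p'.
Proof.
by move=> prp prp' e; apply/seteqP; split; apply: extend_subsetK => //; rewrite e.
Qed.

Lemma extend_proper (p p' : set Z) : prime_set p -> p `<` p' -> extend p `<` extend p'.
Proof.
move=> prp [sub np]; split; first exact: extend_subset.
by move=> h; apply: np; apply: extend_subsetK.
Qed.

(** All members of the chain lie in P and hence avoid z and z', so each is the extension of its
    contraction; strict inclusions therefore remain strict in C[z, z']. *)
Lemma prime_chain_contract (P : set U) m c : prime_chain P m c ->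
  ~ P (z q) -> ~ P (z' q) ->
  exists p : nat -> set Z, [/\ forall i, (i <= m)%N -> prime_set (p i),
    forall i, (i < m)%N -> p i `<` p i.+1 & P = extend (p m)].
Proof.
move=> [cpr cinc cm] Pz Pz'.
have csub i : (i <= m)%N -> c i `<=` P.
  have sub k : (i + k <= m)%N -> c i `<=` c (i + k)%N.
    elim: k => [|k IH] lk u; first by rewrite addn0.
    by rewrite addnS in lk *; move=> /(IH (ltnW lk)); apply: (cinc _ lk).1.
  by move=> im; rewrite -cm -(subnKC im); apply: sub; rewrite subnKC.
have pr i : (i <= m)%N -> prime_set [set f | c i (ev f)].
  by move=> im; apply: (prime_contract q0 qn1); apply: cpr.
have cE i : (i <= m)%N -> c i = extend [set f | c i (ev f)].
  move=> im; have [ide _ _] := cpr i im.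
  apply: (ideal_eq_extend q0 qn1 ide (pr i im)) => //=; rewrite evX /=.
    by move/(csub i im).
  by move/(csub i im).
exists (fun i => [set f | c i (ev f)]); split=> // [i im|]; last by rewrite -cE.
have [sub nsub] := cinc i im; split=> [f /sub //|h]; apply: nsub.
by rewrite (cE i (ltnW im)) (cE i.+1 im); apply: extend_subset.
Qed.

Lemma prime_set_neq0 (p p' : set Z) : prime_set p -> p `<` p' -> p' <> [set 0].
Proof. by move=> [p0 _ _ _ _] [_ np] e; apply: np; rewrite e => _ ->. Qed.

Lemma calP_avoids P : calP K P -> ~ principal P 'X_0 /\ ~ principal P 'X_1.
Proof.
move=> [irr lP /eqP P0 /eqP P1].
by split=> /(monic_irreducible_principalX irr lP).
Qed.

Lemma point_avoids (a b : K) : a != 0 -> b != 0 ->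
  ~ point_ideal a b 'X_0 /\ ~ point_ideal a b 'X_1.
Proof. by move=> /eqP a0 /eqP b0; rewrite !point_idealE !mevalXU. Qed.

Lemma extend_avoids (p : set Z) : prime_set p -> ~ p 'X_0 -> ~ p 'X_1 ->
  ~ extend p (z q) /\ ~ extend p (z' q).
Proof.
move=> prp pz pz'; have eX i := evX q i.
have -> : z q = ev 'X_0 by rewrite eX.
have -> : z' q = ev 'X_1 by rewrite eX.
by split=> /(extend_evE q0 qn1 prp).
Qed.

Lemma zero_proper_principal (P : Z) : P != 0 -> [set 0] `<` principal P.
Proof.
move=> P0; split=> [_ ->|h]; first by exists 0; rewrite mul0r.
by have /eqP := h _ (principal_id P); rewrite (negPf P0).
Qed.

Lemma principal_height1 P : calP K P -> has_height (extend (principal P)) 1.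
Proof.
move=> cP; have [irr _ _ _] := cP; have [Pz Pz'] := calP_avoids cP.
have prp := mpoly2_irreducible_prime irr; have [P0 _ _] := irr.
have X0 i := @mpolyXi_neq0 K i.
split.
  exists (fun i => if i == 0%N then extend [set 0] else extend (principal P)).
  split=> // [[|i] _|[|i]] //=; first by apply: extend_prime (X0 0) (X0 1); rewrite //; apply: prime_set0.
    exact: extend_prime.
  by move=> _; apply: (extend_proper (prime_set0 K)); apply: zero_proper_principal.
move=> [//|[//|m]] c ch; have [nz nz'] := extend_avoids prp Pz Pz'.
have [p [pr pinc e]] := prime_chain_contract ch nz nz'.
(* In a chain of length at least two, the prime just below the top is nonzero, so the top contracts
   to a point ideal. *)
have pn0 : p m.+1 <> [set 0] by apply: prime_set_neq0 (pr m _) (pinc m _); lia.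
have [x [y e']] := prime_above_nonzero (pr m.+1 (leqnSn _)) (pr m.+2 (leqnn _)) (pinc m.+1 (leqnn _)) pn0.
case: (@principal_neq_point K P x y irr); rewrite -e'.
exact: extend_inj prp (pr _ (leqnn _)) e.
Qed.

Lemma point_height2 a b : a != 0 -> b != 0 -> has_height (extend (point_ideal a b)) 2.
Proof.
move=> a0 b0; have [Pz Pz'] := point_avoids a0 b0.
have prp := point_ideal_prime a b; have X0 i := @mpolyXi_neq0 K i.
pose L : Z := 'X_0 - a%:MP; have irr : irreducible_elt L := mpolyXi_subC_irreducible 0 a.
have prL := mpoly2_irreducible_prime irr.
have L0 x f : principal L f -> f.@[point a x] = 0.
  by case=> g ->; rewrite mevalM mevalB mevalXU mevalC subrr mulr0.
split.
  exists (fun i => if i == 0%N then extend [set 0] else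
                   if i == 1%N then extend (principal L) else extend (point_ideal a b)).
  split=> // [[|[|i]] _|[|[|i]]] //=.
  - by apply: extend_prime (X0 0) (X0 1); rewrite //; apply: prime_set0.
  (* Multiples of z - a vanish at (a, 1), where z and z' take the nonzero values a and 1, so this
     intermediate prime avoids both. *)
  - apply: extend_prime => // /(L0 1); rewrite mevalXU /point /= => /eqP.
      by rewrite (negPf a0).
    by rewrite oner_eq0.
  - exact: extend_prime.
  - by have [L0' _ _] := irr; move=> _; apply: (extend_proper (prime_set0 K)); apply: zero_proper_principal.
  move=> _; apply: (extend_proper prL); split.
    move=> f [g ->]; exists g, 0; by rewrite mul0r addr0.
  move=> /(_ ('X_1 - b%:MP)) h.
  (* Strictness: z' - b takes the value 1 at (a, b + 1), where z - a vanishes. *)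
  have /h/(L0 (b + 1)) : point_ideal a b ('X_1 - b%:MP).
    by apply/point_idealE; rewrite mevalB mevalXU mevalC subrr.
  by rewrite mevalB mevalXU mevalC /point /= addrC addKr => /eqP; rewrite oner_eq0.
move=> [//|[//|[//|m]]] c ch; have [nz nz'] := extend_avoids prp Pz Pz'.
have [p [pr pinc e]] := prime_chain_contract ch nz nz'.
have pn0 : p m.+1 <> [set 0] by apply: prime_set_neq0 (pr m _) (pinc m _); lia.
(* In a chain of length at least three, the prime just below the top is already a point ideal, hence
   maximal. *)
have [||||x [y e']] := @prime_above_nonzero K (p m.+1) (p m.+2).
- by apply: pr; lia.
- by apply: pr; lia.
- by apply: pinc; lia.
- exact: pn0.
have [sub nsub] := pinc m.+2 (leqnn _); case: nsub.
by rewrite e' in sub *; apply: point_ideal_maximal => //; apply: pr.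
Qed.

Lemma stratum0_classification :
  stratum (ideal_gen [set (0 : U)]) =
    [set ideal_gen [set (0 : U)]]
    `|` [set ideal_gen [set ev P] | P in calP K]
    `|` [set ideal_gen [set z q - a%:A; z' q - b%:A]
          | a in [set a : K | a != 0] & b in [set b : K | b != 0]].
Proof.
rewrite ideal_gen0 extend0; apply/seteqP; split=> [P sP|].
  have [Pz Pz'] := stratum_avoids q0 qn1 sP; have [pr _] := sP.
  have [p [prp pz pz' ->]] := avoiding_prime_extend q0 qn1 pr Pz Pz'.
  case: (mpoly2_prime_classification prp) => [e|[Q irr e]|[x [y e]]].
  - by left; left; rewrite e extend0.
  - have [Q' [irr' lQ'] eQ] := mleadc1_irreducible irr.
    left; right; exists Q'; last by rewrite ideal_gen_principal eQ e.
    by split=> //; apply/eqP => eX; [apply: pz|apply: pz'];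
      rewrite e -eQ -eX; apply: principal_id.
  right; exists x; [|exists y].
  - by apply/eqP => x0; apply: pz; rewrite e; apply/point_idealE; rewrite mevalXU.
  - by apply/eqP => y0; apply: pz'; rewrite e; apply/point_idealE; rewrite mevalXU.
  by rewrite ideal_gen_point e.
have X0 i := @mpolyXi_neq0 K i.
move=> _ [[->|[Q cQ <-]]|[a a0 [b b0 <-]]].
- by have := stratum_extend q0 qn1 (prime_set0 K) (X0 0) (X0 1); rewrite extend0.
- rewrite ideal_gen_principal; have [Qz Qz'] := calP_avoids cQ; have [irr _ _ _] := cQ.
  by apply: stratum_extend => //; apply: mpoly2_irreducible_prime.
rewrite ideal_gen_point; have [Qz Qz'] := point_avoids a0 b0.
by apply: stratum_extend => //; apply: point_ideal_prime.
Qed.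

End Heights.

Theorem proposition2p4 (R : realType) (q : R[i])
  (q_neq0 : q != 0)
  (q_nroot1 : forall n : nat, (0 < n)%N -> q ^+ n != 1) :
  [/\ stratum (ideal_gen [set (0 : uqB2 q)]) =
        [set ideal_gen [set (0 : uqB2 q)]]
        `|` [set ideal_gen [set eval_zz' q P] | P in calP R[i]]
        `|` [set ideal_gen [set z q - a%:A; z' q - b%:A]
              | a in [set a : R[i] | a != 0] & b in [set b : R[i] | b != 0]],
      forall P : {mpoly R[i][2]}, calP R[i] P ->
        has_height (ideal_gen [set eval_zz' q P]) 1
    & forall a b : R[i], a != 0 -> b != 0 ->
        has_height (ideal_gen [set z q - a%:A; z' q - b%:A]) 2].
Proof.
split.
- exact: (stratum0_classification q_neq0 q_nroot1).
- move=> P cP; have := principal_height1 q_neq0 q_nroot1 cP.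
  by rewrite -(ideal_gen_principal q_neq0 q_nroot1).
move=> a b a0 b0; have := point_height2 q_neq0 q_nroot1 a0 b0.
by rewrite -(ideal_gen_point q_neq0 q_nroot1).
Qed.
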